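(* Let $\{S_i\}_{i=1}^\infty$ be a convergent sequence of non-negative symmetric (square) matrices. Then there exists a symmetric Borel measure $\mu$ (of finite total mass) on $[0,1]^2$ such that for every natural number $k$, the limit of the sets $C(S_i,k)$ in the Hausdorff metric as $i\to\infty$ is $C(\mu,k)$.
   Context: Natural numbers $k$ are positive. A measure on $[0,1]^2$ is symmetric if it is invariant under $(x,y)\mapsto(y,x)$. For a matrix $S$, $\gamma(S)$ denotes the sum of its entries. $\mathcal{K}(k,n)$ is the set of all non-negative real $k\times n$ matrices with every row sum equal to $n/k$ and every column sum equal to $1$. For an $n\times n$ matrix $S$, $C(S,k)=\{MSM^T : M\in\mathcal{K}(k,n)\}\subset\mathbb{R}^{k\times k}$. A sequence $\{S_i\}$ of non-negative square matrices (sizes may vary with $i$) is convergent if there is a constant $c>0$ with $\gamma(S_i)<c$ for all $i$ and, for every natural number $k$, the sets $C(S_i,k)$ converge to some closed set in $[0,c]^{k\times k}$ with respect to the Hausdorff metric (induced by the entrywise $\ell_1$ norm on $\mathbb{R}^{k\times k}$). For a finite Borel measure $\mu$ on $[0,1]^2$, $C(\mu,k)$ is the topological closure in $\mathbb{R}^{k\times k}$ of the set of all $k\times k$ matrices $M$ with $M(i,j)=\int_{[0,1]^2} f_i(x)f_j(y)\,d\mu(x,y)$, where $f_1,\dots,f_k$ range over all families of non-negative Borel measurable functions on $[0,1]$ with $\sum_{i=1}^k f_i=1$ everywhere and $\int_0^1 f_i\,d\lambda=1/k$ for each $i$ ($\lambda$ is Lebesgue measure). *)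

(* Defs.v *)
From HB Require Import structures.
From mathcomp Require Import all_boot all_order all_algebra.
From mathcomp Require Import all_classical all_reals all_analysis.

Set Implicit Arguments.
Unset Strict Implicit.
Unset Printing Implicit Defensive.

Import Order.TTheory GRing.Theory Num.Theory.
Import numFieldNormedType.Exports.

Local Open Scope classical_set_scope.
Local Open Scope ring_scope.

Definition gamma (R : realType) (n : nat) (S : 'M[R]_n) : R :=
  \sum_(i < n) \sum_(j < n) S i j.

Definition nonneg_mx (R : realType) (m n : nat) (S : 'M[R]_(m, n)) : Prop :=
  forall i j, 0 <= S i j.

Definition fractional_partition (R : realType) (k n : nat) :
    set 'M[R]_(k, n) :=
  [set M | [/\ nonneg_mx M,
               forall i, \sum_(j < n) M i j = n%:R / k%:R
             & forall j, \sum_(i < k) M i j = 1]].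
Arguments fractional_partition : clear implicits.

Definition mx_quotients (R : realType) (n : nat) (S : 'M[R]_n) (k : nat) :
    set 'M[R]_k :=
  [set M *m S *m M^T | M in fractional_partition R k n].
Arguments mx_quotients {R n} S k _.

Definition l1_dist (R : realType) (k : nat) (A B : 'M[R]_k) : R :=
  \sum_(i < k) \sum_(j < k) `|A i j - B i j|.

(* Values are extended reals: the distance between an empty and a nonempty
   set is +oo, so a sequence of nonempty sets never converges to set0. *)
Definition dist_to_set (R : realType) (k : nat) (A : 'M[R]_k)
    (Y : set 'M[R]_k) : \bar R :=
  ereal_inf [set (l1_dist A B)%:E | B in Y].

Definition hausdorff_dist (R : realType) (k : nat) (X Y : set 'M[R]_k) :
    \bar R :=
  Order.max (ereal_sup [set dist_to_set A Y | A in X])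
            (ereal_sup [set dist_to_set B X | B in Y]).

(* The limit is required to be closed: the Hausdorff distance separates
   closed sets only, so this makes the limit unique. *)
Definition hausdorff_cvg (R : realType) (k : nat) (X : nat -> set 'M[R]_k)
    (L : set 'M[R]_k) : Prop :=
  closed L /\ hausdorff_dist (X i) L @[i --> \oo] --> 0%E.

Definition convergent_mx_seq (R : realType) (n : nat -> nat)
    (S : forall i, 'M[R]_(n i)) : Prop :=
  exists c : R,
    [/\ 0 < c,
        forall i, gamma (S i) < c
      & forall k : nat, (0 < k)%N ->
          exists L : set 'M[R]_k,
            L `<=` [set A | forall i j, 0 <= A i j <= c] /\
            hausdorff_cvg (fun i => mx_quotients (S i) k) L].

Definition unit_itv (R : realType) : set (measurableTypeR R) := `[0, 1].
Arguments unit_itv : clear implicits.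

Definition unit_square (R : realType) :
    set (measurableTypeR R * measurableTypeR R)%type :=
  unit_itv R `*` unit_itv R.
Arguments unit_square : clear implicits.

(* Finite Borel measures on [0,1]^2 are encoded as finite Borel measures on
   R^2 (the product sigma-algebra) that vanish outside [0,1]^2. *)
Definition supported_on_square (R : realType)
    (mu : {finite_measure set (measurableTypeR R * measurableTypeR R)%type
             -> \bar R}) : Prop :=
  mu (~` unit_square R) = 0%E.

Definition symmetric_measure (R : realType)
    (mu : {finite_measure set (measurableTypeR R * measurableTypeR R)%type
             -> \bar R}) : Prop :=
  forall A : set (measurableTypeR R * measurableTypeR R)%type,
    measurable A -> mu ((fun z => (z.2, z.1)) @^-1` A) = mu A.

Definition balanced_partition_of_unity (R : realType) (k : nat)
    (f : 'I_k -> measurableTypeR R -> R) : Prop :=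
  [/\ forall i, measurable_fun (unit_itv R) (f i),
      forall i x, unit_itv R x -> 0 <= f i x,
      forall x, unit_itv R x -> \sum_(i < k) f i x = 1
    & forall i, (\int[@lebesgue_measure R]_(x in unit_itv R) (f i x)%:E
                 = (k%:R^-1)%:E)%E].

Definition measure_quotients (R : realType)
    (mu : {finite_measure set (measurableTypeR R * measurableTypeR R)%type
             -> \bar R}) (k : nat) : set 'M[R]_k :=
  closure [set M : 'M[R]_k |
    exists2 f : 'I_k -> measurableTypeR R -> R,
      balanced_partition_of_unity f &
      forall i j,
        ((M i j)%:E
         = \int[mu]_(z in unit_square R) (f i z.1 * f j z.2)%:E)%E].
Arguments measure_quotients {R} mu k _.

(* Main.v *)
Require Import Defs.
From HB Require Import structures.
From mathcomp Require Import all_boot all_order all_algebra.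
From mathcomp Require Import all_classical all_reals all_analysis.
From mathcomp Require Import measurable_realfun ring lra.

Set Implicit Arguments.
Unset Strict Implicit.
Unset Printing Implicit Defensive.

Import Order.TTheory GRing.Theory Num.Theory.
Import numFieldNormedType.Exports.

Local Open Scope classical_set_scope.
Local Open Scope ring_scope.

(** The sets C(S_i, k) see S_i only through its finite quotients M S_i M^T, so
    the limit measure is assembled from finer and finer finite quotients, and
    the whole difficulty is that S_i may concentrate its mass on very few
    rows: rows of small weight cannot be neglected.

    Refinement.  If M is a fractional partition of S and N S N^T is a quotient
    to be remembered, the rows M(a, _) N(i, _) of the common refinement know
    both, but have unequal weights.  In [split_row] each of them is cut into
    equal pieces, and every piece is topped up to the common weight with a
    small multiple of the row M(a, _) itself.  A piece of tiny weight but large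
    mass is thereby kept intact, whereas the filler is a small multiple of M
    and hence carries little mass.  The number d of pieces per row depends on
    the tolerance and on the bound for the total mass, but not on S; therefore
    all the S_i can be refined along the same grids 1, d_0, d_0 d_1, and so on
    ([refinement], [tower_exists]).  The quotients to be remembered run through a countable
    list of targets ([countable_targets]).

    Limit of the quotients.  Along an ultrafilter on the indices i, the
    quotients of level m converge entrywise to a matrix A_m.  These matrices
    form a coherent array: A_m is symmetric and is the block sum of A_(m+1).
    If L_k is the limit of the sets C(S_i, k), then every quotient of every A_m
    belongs to L_k, and such quotients are dense in L_k ([limit_array]).

    From the array to a measure.  A_m(a, b) should be the mass of the cell
    (a, b) of the m-th grid of the unit square.  Dividing an interval of length
    A_0 / 2 again and again in the proportions given by the A_m attaches to
    each t in it a nested sequence of cells, whose corners converge to a point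
    (x t, y t) ([random_addresses], [address_point]).  The image of Lebesgue
    measure under (x, y) plus its image under (y, x) is the required symmetric
    measure mu ([address_measure]).  A point could lie on the boundary of the
    cells of its address and so be attributed to a neighbouring cell; this
    happens at level m only if the cell of level m+1 lies in the last row or
    column of the block that refines the cell of level m.  In each refinement
    the last piece is exactly M(a, _) / d, so these cells carry a mass that
    tends to 0 ([last_children_mass]).

    Comparison of mu with the array.  A partition of the m-th grid becomes a
    partition of unity by step functions, with almost the same quotient
    ([grid_partition_quotient]).  Conversely a balanced partition of unity f is
    close to a step function in L^1 of Lebesgue measure plus the laws of x and y
    ([grid_approx], [finite_grid_approx]): the laws of x and y determine the
    error of the quotient, Lebesgue measure that of the balance, and as these
    laws may be singular the approximation has to serve all three at once.
    The remaining imbalance is repaired by [balance_rows], which proves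
    [partition_grid_quotient].  Since L_k is closed, both comparisons together
    give C(mu, k) = L_k. *)

(** * Quotients of a matrix *)

Lemma sum_ord_mul (V : nmodType) (n d : nat) (F : nat -> V) :
  \sum_(i < n * d) F i = \sum_(i < n) \sum_(u < d) F (i * d + u)%N.
Proof.
elim: n => [|n IH]; first by rewrite mul0n !big_ord0.
by rewrite mulSnr big_split_ord /= IH big_ord_recr.
Qed.

Lemma quotient_entry (R : realType) (k n : nat) (S : 'M[R]_n)
    (X : 'M[R]_(k, n)) i j :
  (X *m S *m X^T) i j = \sum_(v < n) \sum_(w < n) X i v * S v w * X j w.
Proof.
rewrite exchange_big mxE; apply: eq_bigr => w _.
by rewrite !mxE mulr_suml.
Qed.

(** Writing X S X^T - Y S Y^T as (X - Y) S X^T + Y S (X - Y)^T, the factor that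
    is not a difference sums to 1 over its row index, and only the column-wise
    bound on X - Y remains.  No bound on single entries of S is involved, so
    the estimate is uniform over all S of a given total mass. *)
Lemma quotient_dist_le (R : realType) (k n : nat) (S : 'M[R]_n)
    (X Y : 'M[R]_(k, n)) (eta : R) :
  nonneg_mx S -> nonneg_mx X -> nonneg_mx Y ->
  (forall v, \sum_(i < k) X i v = 1) -> (forall v, \sum_(i < k) Y i v = 1) ->
  (forall v, \sum_(i < k) `|X i v - Y i v| <= eta) ->
  l1_dist (X *m S *m X^T) (Y *m S *m Y^T) <= 2 * eta * gamma S.
Proof.
move=> S0 X0 Y0 X1 Y1 XY.
pose D i v := `|X i v - Y i v|.
have le1 i j : `|(X *m S *m X^T) i j - (Y *m S *m Y^T) i j| <=
    \sum_(v < n) \sum_(w < n) (S v w * (D i v * X j w) + S v w * (Y i v * D j w)).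
  rewrite !quotient_entry -sumrB.
  apply: le_trans (ler_norm_sum _ _ _) _; apply: ler_sum => v _.
  rewrite -sumrB; apply: le_trans (ler_norm_sum _ _ _) _.
  apply: ler_sum => w _.
  have -> : X i v * S v w * X j w - Y i v * S v w * Y j w =
    S v w * ((X i v - Y i v) * X j w) + S v w * (Y i v * (X j w - Y j w)) by ring.
  apply: le_trans (ler_normD _ _) _.
  by rewrite !normrM (ger0_norm (S0 _ _)) (ger0_norm (X0 _ _)) (ger0_norm (Y0 _ _)).
rewrite /l1_dist.
apply: (@le_trans _ _ (\sum_(v < n) \sum_(w < n) \sum_(i < k) \sum_(j < k)
   (S v w * (D i v * X j w) + S v w * (Y i v * D j w)))).
  apply: (@le_trans _ _ (\sum_(i < k) \sum_(j < k) \sum_(v < n) \sum_(w < n)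
   (S v w * (D i v * X j w) + S v w * (Y i v * D j w)))).
    by apply: ler_sum => i _; apply: ler_sum.
  under eq_bigr do under eq_bigr do under eq_bigr do [].
  rewrite le_eqVlt; apply/orP; left; apply/eqP.
  under eq_bigr => i _.
    rewrite exchange_big /=; under eq_bigr => v _ do rewrite exchange_big /=.
    over.
  rewrite exchange_big /=; apply: eq_bigr => v _.
  by rewrite exchange_big.
rewrite /gamma mulr_sumr; apply: ler_sum => v _.
rewrite mulr_sumr; apply: ler_sum => w _.
under eq_bigr => i _ do rewrite big_split /= -!mulr_sumr X1 mulr1.
rewrite big_split /= -!mulr_sumr -mulr_suml Y1 mul1r.
rewrite -mulrDr mulrC ler_wpM2r ?S0//.
by rewrite mulr_natl mulr2n lerD ?XY.
Qed.

(** P is (1 - theta) Q plus a correction that is constant on each row.  With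
    theta = j * delta the damping makes every row sum at most its target, so
    that the corrections needed are all nonnegative. *)
Lemma balance_rows (R : realType) (j k : nat) (Q : 'M[R]_(j, k)) (delta : R) :
  (0 < j)%N -> (0 < k)%N -> nonneg_mx Q ->
  (forall a, \sum_(i < j) Q i a = 1) -> 0 <= delta -> j%:R * delta <= 1 ->
  (forall i, `|(\sum_(a < k) Q i a) / k%:R - j%:R^-1| <= delta) ->
  exists2 P, fractional_partition R j k P &
    forall a, \sum_(i < j) `|P i a - Q i a| <= 2 * (j%:R * delta).
Proof.
move=> j0 k0 Q0 Q1 d0 jd Qr.
have jp : 0 < j%:R :> R by rewrite ltr0n.
have kp : 0 < k%:R :> R by rewrite ltr0n.
pose th := j%:R * delta.
have th0 : 0 <= th by rewrite mulr_ge0// ltW.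
pose r i := (\sum_(a < k) Q i a) / k%:R.
pose e i := j%:R^-1 - (1 - th) * r i.
have r1 : \sum_i r i = 1.
  rewrite -mulr_suml exchange_big /=; under eq_bigr do rewrite Q1.
  by rewrite sumr_const card_ord mulfV// gt_eqF.
have e1 : \sum_i e i = th.
  rewrite sumrB -mulr_sumr r1 sumr_const card_ord -[_ *+ _]mulr_natr mulVf ?gt_eqF//.
  by ring.
(* (1 - theta) (1 / j + delta) = 1 / j - theta * delta <= 1 / j *)
have e0 i : 0 <= e i.
  have /ler_normlP[_ rd] : `|r i - j%:R^-1| <= delta := Qr i.
  have : (1 - th) * r i <= (1 - th) * (j%:R^-1 + delta).
    apply: ler_wpM2l; first by rewrite subr_ge0.
    by lra.
  have -> : (1 - th) * (j%:R^-1 + delta) = j%:R^-1 - th * delta.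
    by rewrite /th; field; rewrite gt_eqF.
  have : 0 <= th * delta by rewrite mulr_ge0.
  by rewrite /e; lra.
exists (\matrix_(i, a) ((1 - th) * Q i a + e i)); first split.
- move=> i a; rewrite mxE addr_ge0// mulr_ge0// subr_ge0//.
- move=> i; under eq_bigr do rewrite mxE.
  rewrite big_split /= -mulr_sumr sumr_const card_ord -[_ *+ _]mulr_natr /e /r.
  by field; rewrite !gt_eqF.
- move=> a; under eq_bigr do rewrite mxE.
  by rewrite big_split /= -mulr_sumr Q1 e1; ring.
move=> a.
apply: (@le_trans _ _ (\sum_i (th * Q i a + e i))).
  apply: ler_sum => i _; rewrite mxE.
  have -> : (1 - th) * Q i a + e i - Q i a = e i - th * Q i a by ring.
  apply: le_trans (ler_normB _ _) _.
  by rewrite (ger0_norm (e0 _)) ger0_norm ?mulr_ge0// addrC.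
by rewrite big_split /= -mulr_sumr Q1 e1 /th; lra.
Qed.

(** The labels are distributed as a list: c i copies of each Some i, then None.
    Strictness of the bound on the sum leaves the last place unlabelled. *)
Lemma labelling (j d : nat) (c : 'I_j -> nat) : (\sum_i c i < d)%N ->
  exists lab : nat -> option 'I_j, lab d.-1 = None /\
    forall (V : nmodType) (F : option 'I_j -> V),
      \sum_(u < d) F (lab u) =
      \sum_i F (Some i) *+ c i + F None *+ (d - \sum_i c i).
Proof.
move=> cd.
pose s1 := flatten [seq nseq (c i) (Some i) | i <- enum 'I_j].
pose s := s1 ++ nseq (d - \sum_i c i) None.
have sz1 : size s1 = (\sum_i c i)%N.
  rewrite size_flatten /shape -map_comp sumnE big_map big_enum /=.
  by apply: eq_bigr => i _; rewrite size_nseq.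
have szs : size s = d by rewrite size_cat size_nseq sz1 subnKC// ltnW.
exists (nth None s); split.
  rewrite nth_cat sz1; case: ltnP => [|h]; last by rewrite nth_nseq if_same.
  by rewrite ltnNge -ltnS (ltn_predK cd) cd.
move=> V F.
transitivity (\sum_(x <- s) F x).
  by rewrite [RHS](big_nth None) szs big_mkord.
rewrite big_cat /= big_flatten /= big_map big_enum /=; congr (_ + _).
  by apply: eq_bigr => i _; rewrite big_nseq -Monoid.iteropE.
by rewrite big_nseq -Monoid.iteropE.
Qed.

(** * Refining a fractional partition *)

(** A row m is cut into d rows of equal weight in such a way that the parts
    m * N i are almost recovered by summing the pieces labelled i.  The part
    (1 - theta) (m * N i) is shared out equally among c i pieces, where c i is
    just large enough for each share to have weight at most W / d; the deficit
    is filled up with a multiple of m.  The rounding costs at most one piece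
    per label, which theta * d >= j + 1 pays for.  The unlabelled pieces, among
    them the last one, are m / d. *)
Lemma split_row (R : realType) (j d n : nat) (th : R) (m : 'I_n -> R)
    (N : 'M[R]_(j, n)) :
  (0 < d)%N -> nonneg_mx N -> (forall v, \sum_(i < j) N i v = 1) ->
  (forall v, 0 <= m v) -> 0 < \sum_v m v -> 0 <= th -> th <= 1 ->
  j.+1%:R <= th * d%:R ->
  exists (lab : nat -> option 'I_j) (m' : nat -> 'I_n -> R),
    [/\ forall u v, 0 <= m' u v,
        forall u, \sum_v m' u v = (\sum_v m v) / d%:R,
        forall v, \sum_(u < d) m' u v = m v,
        forall v, m' d.-1 v = m v / d%:R
      & forall i v, (1 - th) * (m v * N i v) <=
                    \sum_(u < d | lab u == Some i) m' u v].
Proof.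
move=> d0 N0 N1 m0 W0 th0 th1 jd.
have dp : 0 < d%:R :> R by rewrite ltr0n.
set W := \sum_v m v in W0 *.
pose w i := (\sum_v m v * N i v) / W.
have w0 i : 0 <= w i by rewrite divr_ge0 ?(ltW W0)// sumr_ge0// => v _; rewrite mulr_ge0.
have w1 : \sum_i w i = 1.
  rewrite -mulr_suml exchange_big /=.
  under eq_bigr => v _ do rewrite -mulr_sumr N1 mulr1.
  by rewrite mulfV// gt_eqF.
pose c i := (Num.truncn (d%:R * (1 - th) * w i)).+1.
have xge0 i : 0 <= d%:R * (1 - th) * w i.
  by apply: mulr_ge0 => //; apply: mulr_ge0; rewrite ?subr_ge0// ltW.
have cge i : d%:R * (1 - th) * w i <= (c i)%:R by rewrite ltW// truncnS_gt.
have cle i : (c i)%:R <= d%:R * (1 - th) * w i + 1.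
  by rewrite /c -natr1 lerD2r truncn_le.
have cp i : 0 < (c i)%:R :> R by rewrite ltr0n.
have cd : (\sum_i c i < d)%N.
  rewrite -(ltr_nat R) natr_sum.
  apply: (@le_lt_trans _ _ (\sum_i (d%:R * (1 - th) * w i + 1))).
    exact: ler_sum.
  rewrite big_split /= -mulr_sumr w1 sumr_const card_ord.
  by move: jd; rewrite -natr1 => jd; lra.
have [lab [labd labS]] := labelling cd.
pose y i := d%:R^-1 - (1 - th) * w i / (c i)%:R.
have y0 i : 0 <= y i.
  rewrite subr_ge0 ler_pdivrMr// [leRHS]mulrC ler_pdivlMr//.
  by rewrite mulrC mulrA; exact: cge.
pose part x v := match x with
  | Some i => (1 - th) / (c i)%:R * (m v * N i v) + y i * m v
  | None => m v / d%:R end.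
have part0 x v : 0 <= part x v.
  case: x => [i|] /=; last by rewrite divr_ge0// ltW.
  apply: addr_ge0; last exact: mulr_ge0.
  by apply: mulr_ge0; [apply: divr_ge0; rewrite ?subr_ge0// ltW | exact: mulr_ge0].
exists lab, (fun u => part (lab u)); split => //.
- move=> u; case: (lab u) => [i|] /=; last by rewrite mulr_suml.
  rewrite big_split /= -!mulr_sumr -/W /y.
  have -> : \sum_v m v * N i v = w i * W by rewrite /w mulfVK// gt_eqF.
  by ring.
- move=> v; rewrite (labS _ (part^~ v)) /=.
  rewrite -[_ *+ (d - _)]mulr_natr natrB ?(ltnW cd)// natr_sum.
  rewrite (eq_bigr (fun i => (1 - th) * m v * N i v + m v / d%:R * (c i)%:R
      - (1 - th) * m v * w i)); last first.
    by move=> i _; rewrite -[LHS]mulr_natr /y; field; rewrite !gt_eqF.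
  rewrite sumrB big_split /= -!mulr_sumr N1 w1.
  by field; rewrite gt_eqF.
- by move=> v; rewrite labd.
move=> i v.
rewrite big_mkcond /=.
have := labS _ (fun x => if x == Some i then part x v else 0); rewrite /= => ->.
rewrite mul0rn addr0 (bigD1 i)//= eqxx big1 ?addr0 => [|l li]; last first.
  by case: eqP => [[E]|]; [rewrite E eqxx in li | rewrite mul0rn].
rewrite -[leRHS]mulr_natr [leRHS]mulrDl.
have -> : (1 - th) / (c i)%:R * (m v * N i v) * (c i)%:R = (1 - th) * (m v * N i v).
  by field; rewrite gt_eqF.
by rewrite lerDl; apply: mulr_ge0; [exact: mulr_ge0 | rewrite ltW].
Qed.

(** Rows are indexed by natural numbers, and entries beyond the k-th row are
    still constrained in [row_family]: the children of row a are then simply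
    the rows a * d + u, without casts between ordinal types. *)
Definition rows_mx (R : realType) (k n : nat) (M : nat -> 'I_n -> R) :
    'M[R]_(k, n) := \matrix_(a < k, v < n) M a v.

Definition row_family (R : realType) (k n : nat) (M : nat -> 'I_n -> R) : Prop :=
  [/\ forall a v, 0 <= M a v,
      forall a, \sum_v M a v = n%:R / k%:R
    & forall v, \sum_(a < k) M a v = 1].

Lemma fractional_partition_comp (R : realType) (j k n : nat)
    (P : 'M[R]_(j, k)) (M : 'M[R]_(k, n)) : (0 < k)%N ->
  fractional_partition R j k P -> fractional_partition R k n M ->
  fractional_partition R j n (P *m M).
Proof.
move=> k0 [P0 Pr Pc] [M0 Mr Mc]; split.
- by move=> i v; rewrite mxE sumr_ge0// => a _; rewrite mulr_ge0.
- move=> i; under eq_bigr do rewrite mxE.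
  rewrite exchange_big /=; under eq_bigr do rewrite -mulr_sumr Mr.
  rewrite -mulr_suml Pr mulrAC mulrCA mulrA mulfK ?mulrA//.
  by rewrite pnatr_eq0 -lt0n.
- move=> v; under eq_bigr do rewrite mxE.
  rewrite exchange_big /=; under eq_bigr do rewrite -mulr_suml Pc mul1r.
  exact: Mc.
Qed.

Lemma row_familyP (R : realType) (k n : nat) (M : nat -> 'I_n -> R) :
  row_family k M -> fractional_partition R k n (rows_mx k M).
Proof.
move=> [M0 M1 M2]; split=> [a v|a|v]; rewrite ?mxE//.
- by under eq_bigr do rewrite mxE.
- by under eq_bigr do rewrite mxE.
Qed.

(** One d serves for all matrices S of mass at most c.  The partition P sends a
    piece labelled i to class i and spreads the unlabelled pieces evenly; the
    result differs from N by at most 2 theta in each column.  Its row sums are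
    off by at most theta, which [balance_rows] corrects. *)
Lemma refinement (R : realType) (j : nat) (c eps : R) :
  (0 < j)%N -> 0 < c -> 0 < eps ->
  exists d : nat, [/\ (1 < d)%N, c / d%:R <= eps &
    forall (k n : nat) (S : 'M[R]_n) (M : nat -> 'I_n -> R) (N : 'M[R]_(j, n)),
      (0 < k)%N -> (0 < n)%N -> nonneg_mx S -> gamma S <= c ->
      row_family k M -> fractional_partition R j n N ->
      exists M' : nat -> 'I_n -> R,
        [/\ row_family (k * d) M',
            forall a v, \sum_(u < d) M' (a * d + u)%N v = M a v,
            forall a v, M' (a * d + d.-1)%N v = M a v / d%:R
          & exists2 P, fractional_partition R j (k * d) P &
              l1_dist (P *m rows_mx (k * d) M' *m S *m (P *m rows_mx (k * d) M')^T)
                      (N *m S *m N^T) <= eps]].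
Proof.
move=> j0 c0 e0.
have jp : 0 < j%:R :> R by rewrite ltr0n.
have [th [th0 jth th4]] : exists th : R,
    [/\ 0 < th, j.+1%:R * th <= 1 & 4 * (j.+1%:R * th) * c <= eps].
  have h0 : 0 < Num.min 1 (eps / (4 * c)).
    by rewrite lt_min ltr01 divr_gt0// mulr_gt0.
  exists (Num.min 1 (eps / (4 * c)) / j.+1%:R); rewrite divr_gt0//; split => //.
    by rewrite mulrC divfK// ge_min lexx.
  rewrite [_ * (_ / _)]mulrC divfK// -mulrA [_ * c]mulrC mulrA.
  by rewrite -ler_pdivlMl ?mulr_gt0// mulrC ge_min lexx orbT.
have th1 : th <= 1.
  apply: le_trans jth; rewrite ler_peMl ?(ltW th0)//.
  by rewrite (ler_nat _ 1).
(* the two terms ensure j.+1 <= th * d and c / d <= eps *)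
pose d := (Num.truncn (j.+1%:R / th) + Num.truncn (c / eps)).+2.
have dp : 0 < d%:R :> R by rewrite ltr0n.
have jd : j.+1%:R <= th * d%:R.
  rewrite mulrC -ler_pdivrMr//; apply: le_trans (ltW (truncnS_gt _)) _.
  by rewrite ler_nat /d ltnS leqW// leq_addr.
exists d; split => //.
  rewrite ler_pdivrMr// mulrC -ler_pdivrMr//.
  apply: le_trans (ltW (truncnS_gt _)) _.
  by rewrite ler_nat /d ltnS leqW// leq_addl.
move=> k n S M N k0 n0 S0 Sc [M0 Mr Mc] [N0 Nr Nc].
have kp : 0 < k%:R :> R by rewrite ltr0n.
have np : 0 < n%:R :> R by rewrite ltr0n.
have Wp a : 0 < \sum_v M a v by rewrite Mr divr_gt0.
have /choice [lab /choice [m' H]] := fun a => split_row (ltn0Sn _ : 0 < d)%N N0 Nc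
   (M0 a) (Wp a) (ltW th0) th1 jd.
pose M' a := m' (a %/ d)%N (a %% d)%N.
have M'E a (u : 'I_d) v : M' (a * d + u)%N v = m' a u v.
  by rewrite /M' divnMDl// divn_small// addn0 modnMDl modn_small.
have kd0 : (0 < k * d)%N by rewrite muln_gt0 k0.
have M'f : row_family (k * d) M'.
  split.
  - by move=> a v; rewrite /M'; case: (H (a %/ d)%N).
  - move=> a; rewrite /M'; case: (H (a %/ d)%N) => _ -> _ _ _.
    by rewrite Mr natrM invfM mulrA.
  - move=> v; rewrite (sum_ord_mul _ _ (M' ^~ v)) -[RHS](Mc v).
    apply: eq_bigr => a _; under eq_bigr do rewrite M'E.
    by case: (H a) => _ _ -> _ _.
exists M'; split => //.
- move=> a v; under eq_bigr do rewrite M'E.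
  by case: (H a) => _ _ -> _ _.
- move=> a v; have := M'E a (@ord_max d.-1) v; rewrite /= => ->.
  by case: (H a) => _ _ _ -> _.
pose q (i : 'I_j) (a : nat) : R := match lab (a %/ d)%N (a %% d)%N with
  | Some l => (l == i)%:R | None => j%:R^-1 end.
pose Q : 'M[R]_(j, k * d) := \matrix_(i, a) q i a.
have Q0 : nonneg_mx Q.
  by move=> i a; rewrite mxE /q; case: (lab _ _) => // _; rewrite invr_ge0 ltW.
have Q1 a : \sum_i Q i a = 1.
  under eq_bigr do rewrite mxE /q.
  case: (lab _ _) => [l|].
    by rewrite (bigD1 l)//= eqxx big1 ?addr0// => i /negbTE; rewrite eq_sym => ->.
  by rewrite sumr_const card_ord -[_ *+ _]mulr_natr mulVf// gt_eqF.
have [_ M'r M'c] := row_familyP M'f.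
have [M'0 _ _] := row_familyP M'f.
set X := rows_mx (k * d) M' in M'r M'c M'0 *.
have QXc v : \sum_i (Q *m X) i v = 1.
  under eq_bigr do rewrite mxE.
  rewrite exchange_big /=; under eq_bigr do rewrite -mulr_suml Q1 mul1r.
  exact: M'c.
(* dropping the filler and the unlabelled pieces leaves (1 - th) N *)
have QXge i v : (1 - th) * N i v <= (Q *m X) i v.
  rewrite mxE.
  rewrite (eq_bigr (fun a : 'I_(k * d) => q i a * M' a v)); last first.
    by move=> a _; rewrite !mxE.
  rewrite (sum_ord_mul _ _ (fun a => q i a * M' a v)).
  apply: (@le_trans _ _ (\sum_(a < k) ((1 - th) * (M a v * N i v)))).
    by rewrite -mulr_sumr -mulr_suml Mc mul1r.
  apply: ler_sum => a _.
  have [m0 _ _ _ hl] := H a.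
  apply: le_trans (hl i v) _.
  rewrite big_mkcond /=; apply: ler_sum => u _.
  rewrite M'E /q divnMDl// divn_small// addn0 modnMDl modn_small//.
  case: (lab a u) => [l|] /=; last by rewrite mulr_ge0// invr_ge0 ltW.
  by rewrite (inj_eq Some_inj); case: (l == i); rewrite ?mul1r ?mul0r.
pose E i v := (Q *m X) i v - (1 - th) * N i v.
have E0 i v : 0 <= E i v by rewrite subr_ge0.
have E1 v : \sum_i E i v = th by rewrite sumrB -mulr_sumr Nc QXc; ring.
have Ele i v : E i v <= th.
  by rewrite -(E1 v) (bigD1 i)//= lerDl sumr_ge0.
have Qr i : `|(\sum_a Q i a) / (k * d)%:R - j%:R^-1| <= th.
  have Qs : (\sum_a Q i a) / (k * d)%:R = (\sum_v (Q *m X) i v) / n%:R.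
    under [in RHS]eq_bigr do rewrite mxE.
    rewrite exchange_big /=; under [in RHS]eq_bigr do rewrite -mulr_sumr M'r.
    have kdp : 0 < (k * d)%:R :> R by rewrite ltr0n.
    rewrite -mulr_suml; move: (\sum_(_ < _) _) (_%:R : R) kdp => s t t0.
    by field; rewrite !gt_eqF.
  have Es : \sum_v (Q *m X) i v = (1 - th) * (n%:R / j%:R) + \sum_v E i v.
    by rewrite sumrB -mulr_sumr Nr; ring.
  have eN : 0 <= (\sum_v E i v) / n%:R <= th.
    rewrite divr_ge0 ?sumr_ge0// ?(ltW np)//= ler_pdivrMr//.
    apply: (@le_trans _ _ (\sum_(v < n) th)); first exact: ler_sum.
    by rewrite sumr_const card_ord mulr_natr.
  rewrite Qs Es.
  have -> : ((1 - th) * (n%:R / j%:R) + \sum_v E i v) / n%:R - j%:R^-1 =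
     (\sum_v E i v) / n%:R - th / j%:R by field; rewrite !gt_eqF.
  have : 0 <= th / j%:R <= th.
    rewrite divr_ge0 ?(ltW th0) ?(ltW jp)//= ler_pdivrMr// ler_peMr ?(ltW th0)//.
    by rewrite (ler_nat _ 1).
  by move: eN => /andP[? ?] /andP[? ?]; rewrite ler_norml; lra.
have jth' : j%:R * th <= 1.
  by apply: le_trans jth; rewrite ler_pM2r// ler_nat.
have [P PK PQ] := balance_rows j0 kd0 Q0 Q1 (ltW th0) jth' Qr.
exists P => //.
have [PX0 _ PXc] := fractional_partition_comp kd0 PK (row_familyP M'f).
apply: le_trans (quotient_dist_le (eta := 2 * (j.+1%:R * th)) S0 PX0 N0 PXc Nc _) _.
  move=> v.
  apply: (@le_trans _ _ (\sum_i (\sum_a `|P i a - Q i a| * X a v + (th * N i v + E i v)))).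
    apply: ler_sum => i _.
    have -> : (P *m rows_mx (k * d) M') i v - N i v =
       \sum_a (P i a - Q i a) * X a v + (E i v - th * N i v).
      rewrite /E [(Q *m X) i v]mxE [in LHS]mxE.
      under [X in _ = X + _]eq_bigr do rewrite mulrBl.
      by rewrite sumrB; ring.
    apply: le_trans (ler_normD _ _) _; apply: lerD.
      apply: le_trans (ler_norm_sum _ _ _) _; apply: ler_sum => a _.
      by rewrite normrM (ger0_norm (M'0 _ _)).
    apply: le_trans (ler_normB _ _) _.
    by rewrite (ger0_norm (E0 _ _)) ger0_norm ?mulr_ge0 ?(ltW th0)// addrC.
  rewrite big_split /= big_split /= -mulr_sumr Nc E1 exchange_big /=.
  have : \sum_a \sum_i `|P i a - Q i a| * X a v <= 2 * (j%:R * th).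
    apply: (@le_trans _ _ (\sum_a (2 * (j%:R * th)) * X a v)).
      by apply: ler_sum => a _; rewrite -mulr_suml ler_wpM2r.
    by rewrite -mulr_sumr M'c mulr1.
  by rewrite -natr1; lra.
apply: le_trans th4.
have -> : 2 * (2 * (j.+1%:R * th)) = 4 * (j.+1%:R * th) by ring.
by rewrite ler_wpM2l// mulr_ge0// mulr_ge0// ltW.
Qed.

(** * Towers of nested partitions *)

Fixpoint grid (d : nat -> nat) (m : nat) : nat :=
  if m is m'.+1 then (grid d m' * d m')%N else 1%N.

Lemma grid_gt0 (d : nat -> nat) : (forall m, 1 < d m)%N ->
  forall m, (0 < grid d m)%N.
Proof. by move=> d2; elim=> //= m IH; rewrite muln_gt0 IH ltnW. Qed.

Lemma grid_ge (d : nat -> nat) : (forall m, 1 < d m)%N ->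
  forall m, (m < grid d m)%N.
Proof.
move=> d2; elim=> //= m IH; apply: (@leq_trans (grid d m * 2)); last first.
  by rewrite leq_pmul2l ?d2// (leq_trans _ IH).
by rewrite muln2 -addnn -addn1 leq_add// (leq_trans _ IH).
Qed.

(** The refinements of the one-row partition in which level m + 1 remembers the
    quotient by N m up to 1 / (m + 1). *)
Definition tower (R : realType) (J d : nat -> nat) (n : nat) (S : 'M[R]_n)
    (N : forall m, 'M[R]_(J m, n)) (M : nat -> nat -> 'I_n -> R) : Prop :=
  forall m, [/\ row_family (grid d m) (M m),
    forall a v, M m a v <= 1,
    forall a v, \sum_(u < d m) M m.+1 (a * d m + u)%N v = M m a v,
    forall a v, M m.+1 (a * d m + (d m).-1)%N v = M m a v / (d m)%:R
  & exists2 P, fractional_partition R (J m) (grid d m.+1) P &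
      l1_dist (P *m rows_mx (grid d m.+1) (M m.+1) *m S *m
                 (P *m rows_mx (grid d m.+1) (M m.+1))^T)
              (N m *m S *m (N m)^T) <= m.+1%:R^-1].

Lemma tower_exists (R : realType) (J : nat -> nat) (c : R) :
  (forall m, 0 < J m)%N -> 0 < c ->
  exists d : nat -> nat, [/\ forall m, (1 < d m)%N,
    forall m, c / (d m)%:R <= m.+1%:R^-1 &
    forall (n : nat) (S : 'M[R]_n) (N : forall m, 'M[R]_(J m, n)),
      (0 < n)%N -> nonneg_mx S -> gamma S <= c ->
      (forall m, fractional_partition R (J m) n (N m)) ->
      exists M, tower d S N M].
Proof.
move=> J0 c0.
have e0 m : 0 < m.+1%:R^-1 :> R by rewrite invr_gt0.
have /choice [d H] := fun m => refinement (J0 m) c0 (e0 m).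
have d2 m : (1 < d m)%N by case: (H m).
exists d; split; [exact: d2 | by move=> m; case: (H m) |].
move=> n S N n0 S0 Sc NK.
have step (mM : nat * (nat -> 'I_n -> R)) : exists M', row_family (grid d mM.1) mM.2 ->
    [/\ row_family (grid d mM.1.+1) M',
    forall a v, \sum_(u < d mM.1) M' (a * d mM.1 + u)%N v = mM.2 a v,
    forall a v, M' (a * d mM.1 + (d mM.1).-1)%N v = mM.2 a v / (d mM.1)%:R
  & exists2 P, fractional_partition R (J mM.1) (grid d mM.1.+1) P &
      l1_dist (P *m rows_mx (grid d mM.1.+1) M' *m S *m
                 (P *m rows_mx (grid d mM.1.+1) M')^T)
              (N mM.1 *m S *m (N mM.1)^T) <= mM.1.+1%:R^-1].
  case: mM => m M /=; have [MF|nMF] := pselect (row_family (grid d m) M); last by exists M.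
  have [_ _ Hm] := H m.
  have [M' HM'] := Hm _ _ _ _ _ (grid_gt0 d2 m) n0 S0 Sc MF (NK m).
  by exists M'.
have [next nextP] := choice step.
pose M := fix M m := if m is m'.+1 then next (m', M m') else fun _ _ => 1.
have MF m : row_family (grid d m) (M m).
  elim: m => [|m IH]; last by case: (nextP (m, M m) IH).
  split => //= [a|v]; last by rewrite big_ord1.
  by rewrite sumr_const card_ord divr1.
exists M => m; have [_ h1 h2 h3] := nextP (m, M m) (MF m).
split => //.
elim: {h1 h2 h3} m => [|m IH] a v //.
have /= [[M0 _ _] h _ _] := nextP (m, M m) (MF m).
apply: le_trans (IH (a %/ d m)%N v).
rewrite -h /= {1}(divn_eq a (d m)).
have am : (a %% d m < d m)%N by rewrite ltn_pmod// ltnW.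
by rewrite (bigD1 (Ordinal am))//= lerDl sumr_ge0// => u _; exact: M0.
Qed.

Lemma grid_nested_sum (R : realType) (n d : nat) (S : 'M[R]_n)
    (M M' : nat -> 'I_n -> R) (a b : nat) :
  (forall a v, \sum_(u < d) M' (a * d + u)%N v = M a v) ->
  \sum_(u < d) \sum_(u' < d)
    (\sum_v \sum_w M' (a * d + u)%N v * S v w * M' (b * d + u')%N w)
   = \sum_v \sum_w M a v * S v w * M b w.
Proof.
move=> H.
transitivity (\sum_v \sum_w \sum_(u < d) \sum_(u' < d)
    M' (a * d + u)%N v * S v w * M' (b * d + u')%N w).
  under eq_bigr => u _.
    rewrite exchange_big /=; under eq_bigr do rewrite exchange_big /=.
    over.
  by rewrite exchange_big /=; apply: eq_bigr => v _; rewrite exchange_big.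
apply: eq_bigr => v _; apply: eq_bigr => w _.
by under eq_bigr do rewrite -mulr_sumr H; rewrite -!mulr_suml H.
Qed.

(** * Hausdorff limits and targets *)

Lemma l1_dist_sym (R : realType) (k : nat) (A B : 'M[R]_k) :
  l1_dist A B = l1_dist B A.
Proof. by rewrite /l1_dist; under eq_bigr do under eq_bigr do rewrite distrC. Qed.

Lemma l1_dist_triangle (R : realType) (k : nat) (B A C : 'M[R]_k) :
  l1_dist A C <= l1_dist A B + l1_dist B C.
Proof.
rewrite /l1_dist -big_split /=; apply: ler_sum => i _.
by rewrite -big_split /=; apply: ler_sum => j _; rewrite ler_distD.
Qed.

(** Taking quotients contracts the l1 distance, because a fractional partition
    distributes each entry of A - B with total weight 1. *)
Lemma l1_dist_quotient (R : realType) (j k : nat) (P : 'M[R]_(j, k))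
    (A B : 'M[R]_k) : nonneg_mx P -> (forall a, \sum_i P i a = 1) ->
  l1_dist (P *m A *m P^T) (P *m B *m P^T) <= l1_dist A B.
Proof.
move=> P0 P1; rewrite /l1_dist.
apply: (@le_trans _ _ (\sum_(i < j) \sum_(i' < j) \sum_(a < k) \sum_(b < k)
    P i a * `|A a b - B a b| * P i' b)).
  apply: ler_sum => i _; apply: ler_sum => i' _.
  rewrite !quotient_entry -sumrB; apply: le_trans (ler_norm_sum _ _ _) _.
  apply: ler_sum => a _; rewrite -sumrB; apply: le_trans (ler_norm_sum _ _ _) _.
  apply: ler_sum => b _; rewrite -mulrBl -mulrBr !normrM.
  by rewrite (ger0_norm (P0 _ _)) (ger0_norm (P0 _ _)).
under eq_bigr => i _.
  rewrite exchange_big /=; under eq_bigr do rewrite exchange_big /=.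
  under eq_bigr do under eq_bigr do rewrite -mulr_sumr P1 mulr1.
  over.
rewrite /= exchange_big /=; apply: ler_sum => a _.
by rewrite exchange_big /=; apply: ler_sum => b _; rewrite -mulr_suml P1 mul1r.
Qed.

Lemma closure_l1 (R : realType) (k : nat) (Z : set 'M[R]_k) (X : 'M[R]_k) :
  (forall eps, 0 < eps -> exists2 Y, Z Y & l1_dist X Y < eps) -> closure Z X.
Proof.
move=> H B /nbhs_ballP[e /= e0 eB].
have [Y ZY XY] := H _ e0; exists Y; split => //; apply: eB.
split => // i j; rewrite /ball /=; apply: le_lt_trans XY.
rewrite /l1_dist (bigD1 i)//= (bigD1 j)//= -addrA lerDl.
by rewrite addr_ge0// sumr_ge0// => ? _; rewrite ?sumr_ge0.
Qed.

Lemma hausdorff_cvg_near (R : realType) (k : nat) (X : nat -> set 'M[R]_k)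
    (L : set 'M[R]_k) : hausdorff_cvg X L -> forall eps, 0 < eps ->
  \forall i \near \oo,
    (forall A, X i A -> exists2 B, L B & l1_dist A B < eps) /\
    (forall B, L B -> exists2 A, X i A & l1_dist B A < eps).
Proof.
move=> [_ XL] eps e0.
have lt0 : (0 < eps%:E)%E by rewrite lte_fin.
have : \forall i \near \oo, (hausdorff_dist (X i) L < eps%:E)%E.
  exact: XL (open_ereal_lt' lt0).
apply: filterS => i; rewrite /hausdorff_dist gt_max => /andP[h1 h2].
have dist_lt (A : 'M[R]_k) Y : (dist_to_set A Y < eps%:E)%E ->
    exists2 B, Y B & l1_dist A B < eps.
  by move=> /ereal_inf_lt[_ [B YB <-]]; rewrite lte_fin => ?; exists B.
split=> [A XA|B LB]; apply: dist_lt.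
- by apply: le_lt_trans h1; apply: ereal_sup_ubound; exists A.
- by apply: le_lt_trans h2; apply: ereal_sup_ubound; exists B.
Qed.

(** The target matrices are rational with a common denominator, so that they are
    coded by finite sequences of natural numbers.  The code of m is read off
    from the exponent of 2 in m; multiplying by powers of 3 makes every code
    occur at arbitrarily large m. *)
Lemma countable_targets (R : realType) :
  exists (J : nat -> nat) (tol : nat -> R) (T : nat -> nat -> nat -> R),
    [/\ forall m, (0 < J m)%N, forall m, 0 < tol m &
      forall (j : nat) (B : 'M[R]_j) (eps : R) (m0 : nat), (0 < j)%N ->
        nonneg_mx B -> 0 < eps ->
        exists m, [/\ (m0 <= m)%N, J m = j, tol m <= eps &
          l1_dist B (\matrix_(a, b) T m a b) <= tol m]].
Proof.
pose code m : nat * nat * seq nat :=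
  odflt (0, 0, [::])%N (unpickle (logn 2 m)).
pose J m := (code m).1.1.+1.
pose tol m : R := (code m).1.2.+1%:R^-1.
pose T m a b : R :=
  (nth 0 (code m).2 (a * J m + b))%N%:R / ((J m)%:R ^+ 2 * (code m).1.2.+1%:R).
exists J, tol, T; split=> [//|m|j B eps m0 j0 B0 e0]; first by rewrite invr_gt0.
pose q := Num.truncn eps^-1.
pose D : R := j%:R ^+ 2 * q.+1%:R.
have D0 : 0 < D by rewrite mulr_gt0// exprn_gt0// ltr0n.
case: j j0 B B0 @D D0 => // j _ B B0 D D0.
pose s := mkseq (fun x => Num.truncn
  (D * B (inord (x %/ j.+1)) (inord (x %% j.+1)))) (j.+1 * j.+1).
pose p := pickle (j, q, s).
pose m := (2 ^ p * 3 ^ m0)%N.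
have codem : code m = (j, q, s).
  rewrite /code /m lognM ?expn_gt0// !lognX logn_prime// eqxx muln1.
  by rewrite logn_prime//= muln0 addn0 /p pickleK.
exists m; split.
- by rewrite /m (leq_trans (ltnW (ltn_expl m0 (isT : 1 < 3)%N)))// leq_pmull// expn_gt0.
- by rewrite /J codem.
- rewrite /tol codem /= -[leRHS]invrK lef_pV2 ?posrE ?invr_gt0//.
  by rewrite ltW// truncnS_gt.
apply: (@le_trans _ _ (\sum_(a < j.+1) \sum_(b < j.+1) D^-1)).
  apply: ler_sum => a _; apply: ler_sum => b _; rewrite mxE /T /J codem /=.
  rewrite nth_mkseq; last first.
    have : (a * j.+1 + b < a.+1 * j.+1)%N by rewrite mulSnr ltn_add2l.
    by move=> /leq_trans; apply; rewrite leq_mul2r ltn_ord orbT.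
  rewrite divnMDl// divn_small// addn0 modnMDl modn_small// !inord_val -/D.
  set x := D * B a b.
  have x0 : 0 <= x by rewrite mulr_ge0// ltW.
  have -> : B a b - (Num.truncn x)%:R / D = (x - (Num.truncn x)%:R) / D.
    by rewrite /x; field; rewrite gt_eqF.
  rewrite normrM [X in _ * X]gtr0_norm ?invr_gt0// ler_piMl ?invr_ge0 ?(ltW D0)//.
  have := truncn_le x; have := truncnS_gt x.
  by rewrite -natr1 x0 => h1 h2; rewrite ler_norml; lra.
under eq_bigr do rewrite sumr_const card_ord.
rewrite sumr_const card_ord -[_ *+ _]mulr_natr -[_ *+ _]mulr_natr /tol codem /= /D.
have j0 : j.+1%:R != 0 :> R by rewrite pnatr_eq0.
have q0 : q.+1%:R != 0 :> R by rewrite pnatr_eq0.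
rewrite le_eqVlt; apply/orP; left; apply/eqP.
by move: (j.+1%:R : R) (q.+1%:R : R) j0 q0 => x y x0 y0; field; apply/andP.
Qed.

(** An ultrafilter makes all the countably many sequences of matrix entries
    converge at once and replaces a diagonal extraction of subsequences. *)
Lemma ultralimit (R : realType) : exists U : set_system nat,
  [/\ ProperFilter U, \oo `<=` U &
    forall (c : R) (x : nat -> R), (forall i, 0 <= x i <= c) ->
      exists l : R, x i @[i --> U] --> l].
Proof.
have [U [UU oU]] := ultraFilterLemma (T := nat) (F := \oo) _.
exists U; split => // [|c x xc]; first exact: ultra_proper.
have cpt := @segment_compact R 0 c; rewrite compact_ultra in cpt.
have UX : UltraFilter (x @ U).
  split; first exact: fmap_proper_filter.
  move=> G GF xG; rewrite predeqE => A; split; last exact: xG.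
  move=> GA; have [//|nA] := in_ultra_setVsetC (x @^-1` A) UU.
  have /filter_ex[y [//]] : G (A `&` ~` A) by apply: filterI => //; exact: xG.
have [|l [_ xl]] := cpt _ UX; last by exists l.
by apply: (@filterS _ U _ setT) => [i _|]; [rewrite /= in_itv /=; exact: xc | exact: filterT].
Qed.

(** * The limiting array of quotients *)

Definition array_mx (R : realType) (d : nat -> nat) (A : nat -> nat -> nat -> R)
    (m : nat) : 'M[R]_(grid d m) := \matrix_(a, b) A m a b.

(** The bound on the last children is what prevents the limit measure from
    losing track of cells: see [cell_point] and [last_children_mass]. *)
Definition coherent_array (R : realType) (d : nat -> nat)
    (A : nat -> nat -> nat -> R) : Prop :=
  [/\ forall m a b, 0 <= A m a b,
      forall m a b, A m a b = A m b a,
      forall m a b, \sum_(u < d m) \sum_(v < d m)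
        A m.+1 (a * d m + u)%N (b * d m + v)%N = A m a b
    & forall m, \sum_(a < grid d m) \sum_(b < grid d m.+1)
        A m.+1 (a * d m + (d m).-1)%N b <= m.+1%:R^-1].

Lemma dependent_choice_fun (X : Type) (Y : X -> Type) (P : forall x, Y x -> Prop) :
  (forall x, exists y, P x y) -> exists f : forall x, Y x, forall x, P x (f x).
Proof.
by move=> H; exists (fun x => projT1 (cid (H x))) => x; case: cid.
Qed.

Lemma cvg_sum_ord (R : realType) (T : Type) (F : set_system T) {FF : Filter F}
    (n : nat) (f : 'I_n -> T -> R) (l : 'I_n -> R) :
  (forall i, f i x @[x --> F] --> l i) ->
  \sum_i f i x @[x --> F] --> \sum_i l i.
Proof.
elim: n f l => [|n IH] f l H.
  by rewrite big_ord0; under eq_fun do rewrite big_ord0; exact: cvg_cst.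
rewrite big_ord_recl; under eq_fun do rewrite big_ord_recl.
by apply: cvgD; [exact: H | apply: IH => i; exact: H].
Qed.

Lemma entries_cvg_l1 (R : realType) (T : Type) (F : set_system T)
    {FF : Filter F} (k : nat) (X : T -> 'M[R]_k) (Y : 'M[R]_k) (eps : R) :
  (forall a b, X t a b @[t --> F] --> Y a b) -> 0 < eps ->
  \forall t \near F, l1_dist (X t) Y < eps.
Proof.
move=> XY e0.
have : l1_dist (X t) Y @[t --> F] --> 0.
  rewrite -[X in _ --> X](_ : \sum_(a < k) \sum_(b < k) `|Y a b - Y a b| = 0).
    apply: cvg_sum_ord => a; apply: cvg_sum_ord => b.
    by apply: cvg_norm; apply: cvgB; [exact: XY | exact: cvg_cst].
  by rewrite big1// => a _; rewrite big1// => b _; rewrite subrr normr0.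
move=> /cvgr_dist_lt/(_ _ e0); apply: filterS => t /=.
by rewrite sub0r normrN; apply: le_lt_trans; rewrite ler_norm.
Qed.

(** For each i and m the quotient to be remembered is one within 2 * tol m of
    the m-th target, if there is one.  A matrix B of L_j close to that target
    is close to members of C(S_i, j) for large i, hence such quotients exist
    for large i, and the refined quotients at level m + 1 have a quotient near
    B.  The fractional partition P used for this may be taken from a single i:
    quotients by a fixed P contract distances, and A_(m+1) is close to the
    refined quotient of S_i for that i. *)
Lemma limit_array (R : realType) (n : nat -> nat) (S : forall i, 'M[R]_(n i))
    (c : R) :
  (forall i, 0 < n i)%N -> (forall i, nonneg_mx (S i)) ->
  (forall i, (S i)^T = S i) -> 0 < c -> (forall i, gamma (S i) <= c) ->
  exists (d : nat -> nat) (A : nat -> nat -> nat -> R),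
    [/\ forall m, (1 < d m)%N, coherent_array d A &
      forall (j : nat) (L : set 'M[R]_j), (0 < j)%N ->
        L `<=` [set B | nonneg_mx B] ->
        hausdorff_cvg (fun i => mx_quotients (S i) j) L ->
        (forall m P, fractional_partition R j (grid d m) P ->
           L (P *m array_mx d A m *m P^T)) /\
        (forall B eps m0, L B -> 0 < eps -> exists2 m, (m0 <= m)%N &
           exists2 P, fractional_partition R j (grid d m) P &
             l1_dist (P *m array_mx d A m *m P^T) B <= eps)].
Proof.
move=> n0 S0 St c0 Sc.
have [J [tol [T [J0 tol0 targets]]]] := countable_targets R.
have [d [d2 dc towers]] := tower_exists J0 c0.
(* the second half is vacuous when no quotient of S i meets the target *)
pose hits i m (N : 'M[R]_(J m, n i)) := fractional_partition R (J m) (n i) N /\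
  ((exists2 N', fractional_partition R (J m) (n i) N' &
      l1_dist (N' *m S i *m N'^T) (\matrix_(a, b) T m a b) <= tol m *+ 2) ->
   l1_dist (N *m S i *m N^T) (\matrix_(a, b) T m a b) <= tol m *+ 2).
have /dependent_choice_fun [N NP] : forall i, exists N : forall m, 'M[R]_(J m, n i),
    forall m, hits i m (N m).
  move=> i; apply: dependent_choice_fun => m.
  have [[N' NK NT]|no] := pselect (exists2 N', fractional_partition R (J m) (n i) N' &
      l1_dist (N' *m S i *m N'^T) (\matrix_(a, b) T m a b) <= tol m *+ 2).
    by exists N'.
  exists (const_mx (J m)%:R^-1); split => //; split=> [a b|a|b].
  - by rewrite mxE invr_ge0.
  - by under eq_bigr do rewrite mxE; rewrite sumr_const card_ord mulr_natl.
  - under eq_bigr do rewrite mxE; rewrite sumr_const card_ord -[_ *+ _]mulr_natr mulVf//.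
    by rewrite pnatr_eq0 -lt0n.
have /dependent_choice_fun [M Mtower] := fun i => towers (n i) (S i) (N i) (n0 i) (S0 i) (Sc i)
  (fun m => (NP i m).1).
pose Q m a b i : R := \sum_v \sum_w M i m a v * S i v w * M i m b w.
have [U [UP oU Ulim]] := ultralimit R.
have meets (X Y : set nat) : U X -> \oo Y -> exists i, X i /\ Y i.
  by move=> UX /oU UY; exact: (@filter_ex _ U UP _ (filterI UX UY)).
have M0 i m a v : 0 <= M i m a v by case: (Mtower i m) => -[h _ _] _ _ _ _; exact: h.
have M1 i m a v : M i m a v <= 1 by case: (Mtower i m) => _ h _ _ _; exact: h.
have MF i m : row_family (grid d m) (M i m) by case: (Mtower i m).
have Mn i m a v : \sum_(u < d m) M i m.+1 (a * d m + u)%N v = M i m a v.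
  by case: (Mtower i m) => _ _ h _ _; exact: h.
have Q0 m a b i : 0 <= Q m a b i.
  apply: sumr_ge0 => v _; apply: sumr_ge0 => w _.
  by apply: mulr_ge0 => //; apply: mulr_ge0 => //; exact: S0.
have Qc m a b i : 0 <= Q m a b i <= c.
  rewrite Q0 /=; apply: le_trans (Sc i); apply: ler_sum => v _; apply: ler_sum => w _.
  rewrite -[leRHS]mul1r -[leRHS]mulr1; apply: ler_pM => //.
    by apply: mulr_ge0 => //; exact: S0.
  by apply: ler_pM => //; exact: S0.
have /choice [A AP] : forall m, exists A : nat -> nat -> R,
    forall a b, Q m a b i @[i --> U] --> A a b.
  move=> m; suff /choice [A AP] : forall ab, exists l : R, Q m ab.1 ab.2 i @[i --> U] --> l.
    by exists (fun a b => A (a, b)) => a b; exact: (AP (a, b)).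
  by move=> ab; exact: Ulim (Qc m ab.1 ab.2).
have lim_unique (x : nat -> R) (l l' : R) : x i @[i --> U] --> l -> x i @[i --> U] --> l' -> l = l'.
  by move=> h h'; exact: norm_cvg_unique h h'.
exists d, A; split => //.
  split.
  - move=> m a b; apply: (ler_cvg_to (cvg_cst (0 : R)) (AP m a b)).
    by apply: nearW => i; exact: Q0.
  - move=> m a b; apply: lim_unique (AP m a b) _.
    have -> : Q m a b = Q m b a; last exact: AP.
    apply/funext => i; rewrite /Q exchange_big /=; apply: eq_bigr => v _.
    apply: eq_bigr => w _; rewrite -[in RHS]St mxE.
    by ring.
  - move=> m a b; apply: lim_unique (AP m a b).
    have -> : Q m a b = fun i => \sum_(u < d m) \sum_(v < d m)
         Q m.+1 (a * d m + u)%N (b * d m + v)%N i.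
      by apply/funext => i; rewrite /Q (grid_nested_sum _ _ _ (Mn i m)).
    by apply: cvg_sum_ord => u; apply: cvg_sum_ord => v; exact: AP.
  - move=> m; apply: le_trans (dc m).
    apply: (@ler_cvg_to _ U _ _ _ _ _ _ _ (cvg_cst (c / (d m)%:R))).
      by apply: cvg_sum_ord => a; apply: cvg_sum_ord => b; exact: AP.
    apply: nearW => i.
    apply: (@le_trans _ _ (gamma (S i) / (d m)%:R)); last first.
      by rewrite ler_wpM2r ?invr_ge0.
    rewrite le_eqVlt; apply/orP; left; apply/eqP.
    rewrite /Q /gamma mulr_suml.
    transitivity (\sum_v \sum_w \sum_(a < grid d m) \sum_(b < grid d m.+1)
        M i m.+1 (a * d m + (d m).-1)%N v * S i v w * M i m.+1 b w).
      under eq_bigr => a _.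
        rewrite exchange_big /=; under eq_bigr do rewrite exchange_big /=.
        over.
      by rewrite exchange_big /=; apply: eq_bigr => v _; rewrite exchange_big.
    apply: eq_bigr => v _; rewrite mulr_suml; apply: eq_bigr => w _.
    have [_ _ _ hl _] := Mtower i m; have [_ _ h1] := MF i m; have [_ _ h2] := MF i m.+1.
    under eq_bigr do rewrite -mulr_sumr h2 mulr1 hl.
    by rewrite -mulr_suml -mulr_suml h1 mul1r mulrC.
have Amx m eps : 0 < eps -> \forall i \near U,
    l1_dist (rows_mx (grid d m) (M i m) *m S i *m (rows_mx (grid d m) (M i m))^T)
            (array_mx d A m) < eps.
  move=> e0; apply: (entries_cvg_l1 _ e0) => a b; rewrite mxE.
  under eq_fun => i.
    rewrite quotient_entry.
    under eq_bigr do under eq_bigr do rewrite !mxE.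
    over.
  exact: AP.
have near_dist m j (P : 'M[R]_(j, grid d m)) eps :
    fractional_partition R j (grid d m) P -> 0 < eps -> \forall i \near U,
    l1_dist ((P *m rows_mx (grid d m) (M i m)) *m S i *m (P *m rows_mx (grid d m) (M i m))^T)
            (P *m array_mx d A m *m P^T) < eps.
  move=> [P0 _ P1] e0; apply: filterS (Amx m _ e0) => i; apply: le_lt_trans.
  by apply: le_trans (l1_dist_quotient _ _ P0 P1); rewrite trmx_mul !mulmxA.
move=> j L j0 L0 XL; split.
  move=> m P PK; have [Lcl _] := XL; rewrite ((closure_id L).1 Lcl).
  apply: closure_l1 => eps e0.
  have e2 : 0 < eps / 2 by rewrite divr_gt0.
  have [i [/= h1 [h2 _]]] := meets _ _ (near_dist m j P _ PK e2)
     (hausdorff_cvg_near XL e2).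
  pose PM := P *m rows_mx (grid d m) (M i m).
  have [|Y LY XY] := h2 (PM *m S i *m PM^T).
    exists PM => //.
    by apply: fractional_partition_comp PK (row_familyP (MF i m)); exact: grid_gt0.
  exists Y => //.
  apply: le_lt_trans (l1_dist_triangle (PM *m S i *m PM^T) _ _) _.
  by rewrite l1_dist_sym [ltRHS]splitr ltrD.
move=> B eps m0 LB e0.
have e8 : 0 < eps / 8 by rewrite divr_gt0.
have [m [mm0 Jm tole Btol]] := targets j B (eps / 8)
  (m0 + (Num.truncn (8 / eps)).+1)%N j0 (L0 _ LB) e8.
have me : m.+1%:R^-1 <= eps / 8.
  rewrite -[leRHS]invrK lef_pV2 ?posrE ?invr_gt0// invf_div.
  apply: le_trans (ltW (truncnS_gt _)) _; rewrite ler_nat.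
  by apply: leqW; apply: leq_trans mm0; rewrite leq_addl.
exists m.+1; first by apply: leqW; apply: leq_trans mm0; rewrite leq_addr.
subst j.
have [i [/= h1 [_ h2]]] := meets _ _ (Amx m.+1 _ e8) (hausdorff_cvg_near XL (tol0 m)).
have [_ NT] := NP i m.
have [_ _ _ _ [P PK PN]] := Mtower i m.
exists P => //.
have {}NT := NT _.
have [_ [N' N'K <-] BN'] := h2 _ LB.
have {}NT : l1_dist (N i m *m S i *m (N i m)^T) (\matrix_(a, b) T m a b) <= tol m *+ 2.
  apply: NT; exists N' => //.
  apply: le_trans (l1_dist_triangle B _ _) _.
  by rewrite mulr2n lerD// l1_dist_sym ltW.
have [P0 _ P1] := PK.
set X := rows_mx _ _ in h1 PN.
have PX : l1_dist (P *m array_mx d A m.+1 *m P^T) (P *m X *m S i *m (P *m X)^T) <= eps / 8.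
  rewrite trmx_mul !mulmxA l1_dist_sym.
  have := l1_dist_quotient (X *m S i *m X^T) (array_mx d A m.+1) P0 P1.
  by rewrite !mulmxA => /le_trans; apply; rewrite ltW.
apply: le_trans (l1_dist_triangle (P *m X *m S i *m (P *m X)^T) _ _) _.
apply: le_trans (lerD PX (l1_dist_triangle (N i m *m S i *m (N i m)^T) _ _)) _.
have h3 : l1_dist (N i m *m S i *m (N i m)^T) B <= tol m *+ 2 + tol m.
  apply: le_trans (l1_dist_triangle (\matrix_(a, b) T m a b) _ _) _.
  by rewrite lerD// l1_dist_sym.
move: PN h3 tole me e0; rewrite mulr2n.
move: (l1_dist _ _) (l1_dist _ _) (m.+1%:R^-1 : R) (tol m) => x y z t.
by clear; lra.
Qed.

(** * Step functions *)

(** The index of the interval [F s, F s.+1[ that contains t.  Counting only the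
    first K.-1 right endpoints extends the first and the last interval to
    infinity, so that the index is smaller than K for every t. *)
Definition step_index (R : realType) (F : nat -> R) (K : nat) (t : R) : nat :=
  (\sum_(s < K.-1) (F s.+1 <= t)%R)%N.

Lemma step_index_lt (R : realType) (F : nat -> R) K t : (0 < K)%N ->
  (step_index F K t < K)%N.
Proof.
case: K => // K _; rewrite /step_index /= ltnS.
apply: leq_trans (leq_sum _ (E2 := fun _ => 1%N) _) _; first by move=> s _; case: (_ <= _).
by rewrite sum_nat_const card_ord muln1.
Qed.

Lemma count_initial_segment (p : nat -> bool) (K : nat) :
  (forall r, p r.+1 -> p r) ->
  forall r, (r < K)%N -> p r = (r < \sum_(s < K) p s)%N.
Proof.
move=> pS; have pD r s : (r <= s)%N -> p s -> p r.
  by move=> /subnKC <-; elim: (s - r)%N => [|e IH]; rewrite ?addn0// addnS => /pS.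
elim: K => // K IH r; rewrite ltnS big_ord_recr /= => rK.
have qK : (\sum_(s < K) p s <= K)%N.
  apply: leq_trans (leq_sum _ (E2 := fun _ => 1%N) _) _; first by move=> s _; case: (p s).
  by rewrite sum_nat_const card_ord muln1.
have [pK|npK] := boolP (p K).
  rewrite (pD _ _ rK pK) (_ : \sum_(s < K) p s = K)%N ?addn1 ?ltnS ?rK//.
  rewrite (eq_bigr (fun=> 1%N)) ?sum_nat_const ?card_ord ?muln1// => s _.
  by rewrite (pD s K)// ltnW.
move: rK; rewrite addn0 leq_eqVlt => /predU1P[->|]; last exact: IH.
by rewrite (negbTE npK) ltnNge qK.
Qed.

Lemma step_indexP (R : realType) (F : nat -> R) (K s : nat) (t : R) :
  (forall r, F r <= F r.+1) -> (s < K)%N ->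
  (step_index F K t == s) =
  ((s == 0)%N || (F s <= t)) && ((s.+1 == K) || (t < F s.+1)).
Proof.
move=> FS; case: K => // K sK; rewrite eqSS.
have p : forall r, (r < K)%N -> (F r.+1 <= t) = (r < step_index F K.+1 t)%N.
  apply: (@count_initial_segment (fun r => F r.+1 <= t)) => r.
  by apply: le_trans; exact: FS.
have iK := step_index_lt F t (ltn0Sn K).
set i := step_index _ _ _ in p iK *.
apply/eqP/andP => [<-|[h1 h2]].
- split.
    by case: i p iK => //= i p iK; rewrite p.
  have [//|iK'] := eqVneq i K.
  have {}iK : (i < K)%N by rewrite ltn_neqAle iK' -ltnS.
  by rewrite ltNge p// ltnn.
- apply/eqP; rewrite eqn_leq; apply/andP; split.
    case/predU1P: h2 => [->|]; first by rewrite -ltnS.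
    rewrite ltNge; case: (ltnP s K) => [sK'|]; first by rewrite p// -leqNgt.
    by move=> Ks _; rewrite -ltnS (leq_trans iK).
  case/orP: h1 => [/eqP->//|].
  by case: s sK h2 => // s sK _ h; rewrite -p.
Qed.

Lemma step_index_coarsen (R : realType) (F F' : nat -> R) (K D : nat) (t : R) :
  (forall r, F r <= F r.+1) -> (forall r, F' r <= F' r.+1) ->
  (forall s, F' (s * D)%N = F s) -> (0 < K)%N -> (0 < D)%N ->
  (step_index F' (K * D) t %/ D)%N = step_index F K t.
Proof.
move=> FS FS' FD K0 D0.
have Fmono s r : (s <= r)%N -> F' s <= F' r.
  by move=> /subnKC <-; elim: (r - s)%N => [|e IH]; rewrite ?addn0// addnS (le_trans IH).
have KD0 : (0 < K * D)%N by rewrite muln_gt0 K0.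
have pK := step_index_lt F' t KD0.
set p := step_index _ _ _ in pK *; set s := (p %/ D)%N.
have sK : (s < K)%N by rewrite /s ltn_divLR.
have /andP[h1 h2] : ((p == 0)%N || (F' p <= t)) && ((p.+1 == K * D)%N || (t < F' p.+1)).
  by rewrite -step_indexP.
apply/esym/eqP; rewrite step_indexP//; apply/andP; split.
  have [//|s0 /=] := eqVneq s 0%N; rewrite -FD.
  apply: le_trans (Fmono _ _ (leq_trunc_div _ _)) _; case/orP: h1 => // /eqP p0.
  by move: s0; rewrite /s p0 div0n.
have [//|sK1 /=] := eqVneq s.+1 K; rewrite -FD.
have sp : (p.+1 <= s.+1 * D)%N by rewrite ltn_ceil.
apply: lt_le_trans (Fmono _ _ sp); case/orP: h2 => // /eqP pE.
by move: sp sK1; rewrite pE leq_pmul2r// => Ks; rewrite eqn_leq sK Ks.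
Qed.

Lemma measurable_step_fiber (R : realType) (F : nat -> R) (K s : nat) :
  (forall r, F r <= F r.+1) -> (0 < K)%N ->
  measurable ([set t | step_index F K t = s] : set (measurableTypeR R)).
Proof.
move=> FS K0; case: (ltnP s K) => sK; last first.
  rewrite [X in measurable X](_ : _ = set0)//; apply/seteqP; split=> // t /= E.
  by move: sK; rewrite -E leqNgt step_index_lt.
rewrite [X in measurable X](_ : _ =
  (if (s == 0)%N then setT else `[F s, +oo[%classic) `&`
  (if s.+1 == K then setT else `]-oo, F s.+1[%classic)).
  by apply: measurableI; case: ifP => _ //; exact: measurable_itv.
apply/seteqP; split => t /=.
  move=> /eqP; rewrite step_indexP// => /andP[h1 h2]; split.
    by case: (s == 0)%N h1 => //=; rewrite in_itv /= andbT.
  by case: (s.+1 == K) h2 => //=; rewrite in_itv.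
move=> [h1 h2]; apply/eqP; rewrite step_indexP//; apply/andP; split.
  by case: (s == 0)%N h1 => //=; rewrite in_itv /= andbT.
by case: (s.+1 == K) h2 => //=; rewrite in_itv.
Qed.

Lemma measurable_nat_comp d (T : measurableType d) d' (Y : measurableType d')
    (p : T -> nat) (h : nat -> Y) (D : set T) :
  (forall s, measurable [set t | p t = s]) -> measurable_fun D (h \o p).
Proof.
move=> mp mD B mB; apply: measurableI => //.
rewrite [X in measurable X](_ : _ = \bigcup_(s in h @^-1` B) [set t | p t = s]).
  by apply: bigcup_measurable.
by apply/seteqP; split => [t /= Bt|t [s /= Bs pt]]; [exists (p t) | rewrite /preimage /= pt].
Qed.

Lemma integral_nat_comp d (T : measurableType d) (R : realType)
    (mu : {measure set T -> \bar R}) (D : set T) (p : T -> nat) (K : nat)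
    (h : nat -> R) :
  measurable D -> (forall s, measurable [set t | p t = s]) ->
  (forall t, D t -> (p t < K)%N) -> (forall s, 0 <= h s) ->
  (\int[mu]_(t in D) (h (p t))%:E =
   \sum_(s < K) (h s)%:E * mu (D `&` [set t | p t = s]))%E.
Proof.
move=> mD mp pK h0.
transitivity (\int[mu]_(t in D) (\sum_(s < K) (h s)%:E * (\1_[set t | p t = s] t)%:E))%E.
  apply: eq_integral => t; rewrite inE => Dt.
  rewrite (bigD1 (Ordinal (pK _ Dt)))//= indicE mem_set//= mule1 big1 ?adde0//.
  move=> i ni; rewrite indicE memNset ?mule0//= => E.
  by move: ni; rewrite -val_eqE /= E eqxx.
rewrite ge0_integral_sum//; last 2 first.
- move=> s; apply: measurable_funeM; apply/measurable_EFinP.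
  exact: measurable_indic.
- by move=> s t _; rewrite mule_ge0// lee_fin.
apply: eq_bigr => s _; rewrite ge0_integralZl//.
- by rewrite integral_indic// setIC.
- by apply/measurable_EFinP; exact: measurable_indic.
- by rewrite lee_fin.
Qed.

(** Off E the integrands differ by at most eta, and on E by at most 1; this is
    the form in which exceptional sets of small measure are discarded. *)
Lemma Rintegral_dist_le d (T : measurableType d) (R : realType)
    (mu : {measure set T -> \bar R}) (D E : set T) (u v : T -> R) (eta : R) :
  measurable D -> measurable E -> (mu D < +oo)%E ->
  measurable_fun D u -> measurable_fun D v ->
  (forall t, D t -> 0 <= u t <= 1) -> (forall t, D t -> 0 <= v t <= 1) ->
  0 <= eta -> (forall t, D t -> ~ E t -> `|u t - v t| <= eta) ->
  `|\int[mu]_(t in D) u t - \int[mu]_(t in D) v t| <=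
  eta * fine (mu D) + fine (mu (D `&` E)).
Proof.
move=> mD mE Doo mu_ mv u01 v01 eta0 uv.
have bint (w : T -> R) (c : R) : measurable_fun D w -> (forall t, D t -> `|w t| <= c) ->
    mu.-integrable D (EFin \o w).
  move=> mw wc; apply: measurable_bounded_integrable => //.
  exists c; split; first exact: num_real.
  by move=> x cx t Dt; apply: le_trans (wc _ Dt) (ltW cx).
have norm1 (w : T -> R) : (forall t, D t -> 0 <= w t <= 1) -> forall t, D t -> `|w t| <= 1.
  by move=> w01 t Dt; have /andP[? ?] := w01 _ Dt; rewrite ger0_norm.
have iu := bint _ _ mu_ (norm1 _ u01).
have iv := bint _ _ mv (norm1 _ v01).
rewrite -RintegralB//.
have muv : measurable_fun D (fun t => u t - v t) by exact: measurable_funB.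
have uv1 t : D t -> `|u t - v t| <= 1.
  by move=> Dt; have := u01 _ Dt; have := v01 _ Dt => /andP[? ?] /andP[? ?]; rewrite ler_norml; lra.
have iuv := bint _ _ muv uv1.
apply: le_trans (le_normr_Rintegral _ iuv) _ => //.
have m1E : measurable_fun D (\1_E : T -> R) by exact: measurable_indic.
have i1 : mu.-integrable D (EFin \o (\1_E : T -> R)).
  by apply: (bint _ 1) => // t _; rewrite indicE; case: (_ \in _); rewrite ?normr0 ?normr1.
have ie : mu.-integrable D (EFin \o (fun=> eta)).
  by apply: (bint _ eta) => // t _; rewrite ger0_norm.
apply: (@le_trans _ _ (\int[mu]_(t in D) (eta + \1_E t))).
  apply: le_Rintegral => //.
  - apply: (bint _ 1); first exact: measurableT_comp.
    by move=> t Dt; rewrite normr_id; exact: uv1.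
  - apply: (bint _ (eta + 1)); first exact: measurable_funD.
    move=> t _; apply: le_trans (ler_normD _ _) _; rewrite ger0_norm// lerD2l.
    by rewrite indicE; case: (_ \in _); rewrite ?normr0 ?normr1.
  - move=> t Dt; rewrite indicE; have [Et|nEt] := pselect (E t).
      by rewrite mem_set//= (le_trans (uv1 _ Dt))// lerDr.
    by rewrite memNset//= addr0; exact: uv.
rewrite RintegralD// Rintegral_cst// /Rintegral integral_indic// setIC.
exact: lexx.
Qed.

(** * Random addresses with the masses of the array *)

(** The cells of the m-th grid of the square are numbered so that the children
    of cell s are the numbers s * (d m * d m) + w; the intervals of one level
    then subdivide those of the previous one. *)
Fixpoint decode (d : nat -> nat) (m s : nat) : nat * nat :=
  if m is m'.+1 then
    let p := decode d m' (s %/ (d m' * d m'))%N in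
    let w := (s %% (d m' * d m'))%N in
    (p.1 * d m' + w %/ d m', p.2 * d m' + w %% d m')%N
  else (0, 0)%N.

Lemma decodeE (d : nat -> nat) (m s u v : nat) :
  (u < d m)%N -> (v < d m)%N ->
  decode d m.+1 (s * (d m * d m) + (u * d m + v)) =
  ((decode d m s).1 * d m + u, (decode d m s).2 * d m + v)%N.
Proof.
move=> ud vd; have d0 : (0 < d m)%N by apply: leq_ltn_trans ud.
have wd : (u * d m + v < d m * d m)%N.
  apply: (@leq_trans (u.+1 * d m)); last by rewrite leq_mul2r ud orbT.
  by rewrite mulSnr ltn_add2l.
have dd0 : (0 < d m * d m)%N by rewrite muln_gt0 d0.
rewrite /= divnMDl// modnMDl (divn_small wd) addn0 (modn_small wd).
by rewrite divnMDl// modnMDl (divn_small vd) addn0 (modn_small vd).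
Qed.

Lemma decode_sum (V : nmodType) (d : nat -> nat) (m : nat) (H : nat -> nat -> V) :
  \sum_(s < grid d m * grid d m) H (decode d m s).1 (decode d m s).2 =
  \sum_(a < grid d m) \sum_(b < grid d m) H a b.
Proof.
elim: m H => [|m IH] H; first by rewrite /= !big_ord1.
have -> : (grid d m.+1 * grid d m.+1 = (grid d m * grid d m) * (d m * d m))%N.
  by rewrite mulnACA.
rewrite (sum_ord_mul _ _ (fun s => H (decode d m.+1 s).1 (decode d m.+1 s).2)).
transitivity (\sum_(s < grid d m * grid d m) \sum_(u < d m) \sum_(v < d m)
   H ((decode d m s).1 * d m + u)%N ((decode d m s).2 * d m + v)%N).
  apply: eq_bigr => s _.
  rewrite (sum_ord_mul _ _ (fun w => H (decode d m.+1 (s * (d m * d m) + w)).1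
    (decode d m.+1 (s * (d m * d m) + w)).2)).
  by apply: eq_bigr => u _; apply: eq_bigr => v _; rewrite decodeE.
rewrite (IH (fun a b => \sum_(u < d m) \sum_(v < d m) H (a * d m + u)%N (b * d m + v)%N)).
rewrite (sum_ord_mul _ _ (fun a => \sum_(b < grid d m.+1) H a b)).
apply: eq_bigr => a _; rewrite exchange_big /=; apply: eq_bigr => u _.
by rewrite (sum_ord_mul _ _ (fun b => H (a * d m + u)%N b)).
Qed.

(** The sequence of cell indices of a point in the successive grids of the
    interval, each cell being a child of the preceding one. *)
Definition address (d : nat -> nat) (a : nat -> nat) : Prop :=
  a 0%N = 0%N /\ forall m, (a m.+1 %/ d m)%N = a m.

(** A finite measure space carrying two random addresses whose level-m joint
    law is A m / 2; the factor 1 / 2 is restored by the symmetrization in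
    [address_measure]. *)
Definition address_model (R : realType) (d : nat -> nat)
    (A : nat -> nat -> nat -> R)
    (nu : {finite_measure set (measurableTypeR R) -> \bar R})
    (a b : nat -> measurableTypeR R -> nat) : Prop :=
  [/\ forall m s, measurable [set t | a m t = s],
      forall m s, measurable [set t | b m t = s],
      forall t, address d (a ^~ t),
      forall t, address d (b ^~ t) &
      forall m (h : nat -> nat -> R), (forall x y, 0 <= h x y) ->
        (\int[nu]_t (h (a m t) (b m t))%:E =
         (\sum_(x < grid d m) \sum_(y < grid d m) h x y * (A m x y / 2))%:E)%E].

(** On [0, A_0 / 2[ with Lebesgue measure, the level-m cell of t is the one whose
    number s satisfies F m s <= t < F m s.+1, where F m is the cumulated mass.
    Coherence of the array says that F m.+1 extends F m, hence the cells of t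
    are nested; countable additivity comes for free from Lebesgue measure. *)
Lemma random_addresses (R : realType) (d : nat -> nat)
    (A : nat -> nat -> nat -> R) :
  (forall m, 1 < d m)%N -> coherent_array d A ->
  exists (nu : {finite_measure set (measurableTypeR R) -> \bar R})
         (a b : nat -> measurableTypeR R -> nat), address_model d A nu a b.
Proof.
move=> d2 [A0 _ An _].
pose K m := (grid d m * grid d m)%N.
have K0 m : (0 < K m)%N by rewrite muln_gt0 !grid_gt0.
pose B m s := A m (decode d m s).1 (decode d m s).2 / 2.
pose F m s := \sum_(r < s) B m r.
have B0 m s : 0 <= B m s by rewrite divr_ge0.
have FS m s : F m s.+1 = F m s + B m s by rewrite /F big_ord_recr.
have Fle m s : F m s <= F m s.+1 by rewrite FS lerDl.
have Fmono m s r : (s <= r)%N -> F m s <= F m r.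
  by move=> /subnKC <-; elim: (r - s)%N => [|e IH]; rewrite ?addn0// addnS (le_trans IH).
have Fn m s : F m.+1 (s * (d m * d m))%N = F m s.
  rewrite /F (sum_ord_mul _ _ (B m.+1)); apply: eq_bigr => r _.
  rewrite (sum_ord_mul _ _ (fun w => B m.+1 (r * (d m * d m) + w)%N)).
  rewrite /B -(An m) mulr_suml; apply: eq_bigr => u _; rewrite mulr_suml.
  by apply: eq_bigr => v _; rewrite decodeE.
pose G := A 0%N 0%N 0%N / 2.
have FK m : F m (K m) = G.
  elim: m => [|m <-]; first by rewrite /F big_ord1.
  by rewrite -[RHS]Fn; congr (F _ _); rewrite /K mulnACA.
pose pos m t := step_index (F m) (K m) t.
have posK m t : (pos m t < K m)%N by exact: step_index_lt.
have pos_div m t : (pos m.+1 t %/ (d m * d m))%N = pos m t.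
  have D0 : (0 < d m * d m)%N by rewrite muln_gt0 !(ltnW (d2 m)).
  have KD : K m.+1 = (K m * (d m * d m))%N by rewrite /K /= mulnACA.
  by rewrite /pos KD (step_index_coarsen _ (Fle m) (Fle m.+1) (Fn m) (K0 m) D0).
have mpos m s : measurable ([set t | pos m t = s] : set (measurableTypeR R)).
  exact: measurable_step_fiber.
have mG : measurable (`[0, G[ : set (measurableTypeR R)) by exact: measurable_itv.
have Goo : (@lebesgue_measure R `[0%R, G[%classic < +oo)%E.
  by rewrite lebesgue_measure_itv; case: ifP => _; rewrite ?ltry.
exists (mfrestr mG Goo), (fun m t => (decode d m (pos m t)).1),
   (fun m t => (decode d m (pos m t)).2); split.
- move=> m s; have := @measurable_nat_comp _ _ _ nat (pos m)
    (fun r => (decode d m r).1) setT (mpos m).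
  by move=> /(_ measurableT [set s] I); rewrite setTI.
- move=> m s; have := @measurable_nat_comp _ _ _ nat (pos m)
    (fun r => (decode d m r).2) setT (mpos m).
  by move=> /(_ measurableT [set s] I); rewrite setTI.
- move=> t; split; first by [].
  move=> m; rewrite /= pos_div divnMDl; last by rewrite ltnW.
  by rewrite divn_small ?addn0// ltn_divLR ?ltn_pmod// ?muln_gt0 (ltnW (d2 m)).
- move=> t; split; first by [].
  move=> m; rewrite /= pos_div divnMDl; last by rewrite ltnW.
  by rewrite divn_small ?addn0// ltn_pmod// (ltnW (d2 m)).
move=> m h h0.
have := @integral_nat_comp _ _ R (mfrestr mG Goo) setT (pos m) (K m)
   (fun s => h (decode d m s).1 (decode d m s).2) measurableT (mpos m)
   (fun t _ => posK m t) (fun s => h0 _ _).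
move=> /= ->.
rewrite -(decode_sum _ _ (fun x y => h x y * (A m x y / 2))) -sumEFin.
apply: eq_bigr => s _; rewrite EFinM; congr (_ * _)%E.
rewrite setTI /mfrestr /mrestr.
have sK : (s < K m)%N by [].
transitivity (@lebesgue_measure R `[F m s, F m s.+1[%classic).
  congr (lebesgue_measure _); apply/seteqP; split => t /=; rewrite !in_itv /=.
    move=> [/eqP]; rewrite step_indexP// => /andP[h1 h2] /andP[t0 tG]; apply/andP; split.
      by case/orP: h1 => // /eqP ->; rewrite /F big_ord0.
    by case/orP: h2 => // /eqP ->; rewrite FK.
  move=> /andP[h1 h2]; split.
    by apply/eqP; rewrite step_indexP// h1 h2 !orbT.
  apply/andP; split; first by apply: le_trans h1; exact: sumr_ge0.
  by apply: lt_le_trans h2 _; rewrite -(FK m) Fmono.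
rewrite lebesgue_measure_itv /= lte_fin FS ltrDl.
case: ltP => [_|Bs]; first by rewrite -EFinB addrAC subrr add0r.
by congr EFin; apply/eqP; rewrite eq_le B0 Bs.
Qed.

(** * The point of an address *)

(** The lower endpoints of the cells increase to this supremum. *)
Definition address_point (R : realType) (d a : nat -> nat) : R :=
  sup (range (fun m => (a m)%:R / (grid d m)%:R)).

Definition cell (R : realType) (d : nat -> nat) (m : nat) (x : R) : nat :=
  step_index (fun s => s%:R / (grid d m)%:R) (grid d m) x.

Lemma frac_le (R : realType) (q r : nat) : r%:R / q%:R <= r.+1%:R / q%:R :> R.
Proof. by rewrite ler_wpM2r ?invr_ge0// ler_nat. Qed.

Lemma step_frac_bounds (R : realType) (q : nat) (x : R) :
  (0 < q)%N -> unit_itv R x ->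
  let s := step_index (fun s => s%:R / q%:R) q x in
  s%:R / q%:R <= x <= s.+1%:R / q%:R.
Proof.
move=> q0; rewrite /unit_itv /= in_itv /= => /andP[x0 x1].
have := step_indexP x (@frac_le R q) (step_index_lt (fun s => s%:R / q%:R) x q0).
rewrite eqxx => /esym/andP[h1 h2]; apply/andP; split.
  by case/orP: h1 => // /eqP ->; rewrite mul0r.
by case/orP: h2 => [/eqP->|/ltW//]; rewrite divff// pnatr_eq0 -lt0n.
Qed.

Lemma grid_fracM (R : realType) (d : nat -> nat) (m s : nat) : (forall m, 1 < d m)%N ->
  (s * d m)%:R / (grid d m.+1)%:R = s%:R / (grid d m)%:R :> R.
Proof.
move=> d2; rewrite /= !natrM -mulf_div divff ?mulr1//.
by rewrite pnatr_eq0 -lt0n (ltnW (d2 m)).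
Qed.

Lemma cell_lt (R : realType) (d : nat -> nat) (m : nat) (x : R) :
  (forall m, 1 < d m)%N -> (cell d m x < grid d m)%N.
Proof. by move=> d2; apply: step_index_lt; exact: grid_gt0. Qed.

Lemma cell_bounds (R : realType) (d : nat -> nat) (m : nat) (x : R) :
  (forall m, 1 < d m)%N -> unit_itv R x ->
  (cell d m x)%:R / (grid d m)%:R <= x <= (cell d m x).+1%:R / (grid d m)%:R.
Proof. by move=> d2; apply: step_frac_bounds; exact: grid_gt0. Qed.

Lemma measurable_cell (R : realType) (d : nat -> nat) (m s : nat) :
  (forall m, 1 < d m)%N ->
  measurable ([set x | cell d m x = s] : set (measurableTypeR R)).
Proof.
by move=> d2; apply: measurable_step_fiber; [exact: frac_le | exact: grid_gt0].
Qed.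

Lemma lebesgue_cell (R : realType) (d : nat -> nat) (m s : nat) :
  (forall m, 1 < d m)%N -> (s < grid d m)%N ->
  @lebesgue_measure R (unit_itv R `&` [set x | cell d m x = s]) =
  ((grid d m)%:R^-1)%:E.
Proof.
move=> d2 sg.
have g0 : 0 < (grid d m)%:R :> R by rewrite ltr0n grid_gt0.
rewrite (_ : _ `&` _ = [set` Interval (BLeft (s%:R / (grid d m)%:R : R))
   (BSide (s.+1 != grid d m) (s.+1%:R / (grid d m)%:R))]); last first.
  apply/seteqP; split => x /=; rewrite /unit_itv /= !in_itv /=.
    move=> [/andP[x0 x1] /eqP]; rewrite step_indexP//; last exact: frac_le.
    move=> /andP[h1 h2]; apply/andP; split.
      by case/orP: h1 => // /eqP ->; rewrite mul0r.
    case: eqVneq h2 => [->|] //= _.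
    by rewrite divff ?gt_eqF.
  move=> /andP[h1 h2].
  have x0 : 0 <= x by apply: le_trans h1; rewrite divr_ge0.
  have x1 : x <= 1.
    apply: le_trans (lteifW h2) _.
    by rewrite ler_pdivrMr// mul1r ler_nat.
  split; first by rewrite x0.
  apply/eqP; rewrite step_indexP//; last exact: frac_le.
  by rewrite h1 orbT /=; case: eqVneq h2.
rewrite lebesgue_measure_itv /= lte_fin ltr_pM2r ?invr_gt0// ltr_nat ltnSn.
by rewrite -EFinB -mulrBl -natr1 addrAC subrr add0r mul1r.
Qed.

Lemma integral_cell (R : realType) (d : nat -> nat) (m : nat) (h : nat -> R) :
  (forall m, 1 < d m)%N -> (forall s, 0 <= h s) ->
  (\int[@lebesgue_measure R]_(x in unit_itv R) (h (cell d m x))%:E =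
   ((\sum_(s < grid d m) h s) / (grid d m)%:R)%:E)%E.
Proof.
move=> d2 h0.
have mU : measurable (unit_itv R) by exact: measurable_itv.
have := @integral_nat_comp _ _ R (@lebesgue_measure R) (unit_itv R) (cell d m)
   (grid d m) h mU (fun s => @measurable_cell R d m s d2)
   (fun t _ => cell_lt m t d2) h0.
move=> /= ->; rewrite mulr_suml -sumEFin; apply: eq_bigr => s _.
by rewrite lebesgue_cell// EFinM.
Qed.

Section Address.
Context {R : realType} {d : nat -> nat} {a : nat -> nat}.
Hypotheses (d2 : forall m, (1 < d m)%N) (aP : address d a).

Let g m : R := (grid d m)%:R.
Let g0 m : 0 < g m. Proof. by rewrite ltr0n grid_gt0. Qed.

Lemma address_lt m : (a m < grid d m)%N.
Proof.
case: aP => a0 aS; elim: m => [|m IH]; first by rewrite a0.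
by rewrite /= -ltn_divLR ?(ltnW (d2 m))// aS.
Qed.

Let lower m : (a m)%:R / g m <= (a m.+1)%:R / g m.+1.
Proof.
rewrite -[leLHS](grid_fracM R m (a m) d2) ler_wpM2r ?invr_ge0 ?(ltW (g0 _))//.
by rewrite ler_nat; case: aP => _ /(_ m) <-; exact: leq_trunc_div.
Qed.

Let upper m : (a m.+1).+1%:R / g m.+1 <= (a m).+1%:R / g m.
Proof.
rewrite -[leRHS](grid_fracM R m (a m).+1 d2) ler_wpM2r ?invr_ge0 ?(ltW (g0 _))//.
by rewrite ler_nat; case: aP => _ /(_ m) <-; rewrite ltn_ceil// (ltnW (d2 m)).
Qed.

Let lower_mono : nondecreasing_seq (fun m => (a m)%:R / g m).
Proof. exact/nondecreasing_seqP. Qed.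

Let below m l : (a l)%:R / g l <= (a m).+1%:R / g m.
Proof.
have lu r : (a r)%:R / g r <= (a r).+1%:R / g r by exact: frac_le.
have [ml|/ltnW lm] := leqP l m.
  by apply: le_trans (lower_mono ml) _; exact: lu.
apply: le_trans (lu l) _.
have /nonincreasing_seqP : forall r, (a r.+1).+1%:R / g r.+1 <= (a r).+1%:R / g r by exact: upper.
by apply.
Qed.

Let ub m : ubound (range (fun l => (a l)%:R / g l)) ((a m).+1%:R / g m).
Proof. by move=> _ [l _ <-]; exact: below. Qed.

Lemma point_ge m : (a m)%:R / g m <= address_point R d a.
Proof. by apply: ub_le_sup; [exists ((a 0%N).+1%:R / g 0%N); exact: ub | exists m]. Qed.

Lemma point_le m : address_point R d a <= (a m).+1%:R / g m.
Proof. by apply: ge_sup; [exists ((a 0%N)%:R / g 0%N); exists 0%N | exact: ub]. Qed.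

Lemma point_cvg : (a m)%:R / g m @[m --> \oo] --> address_point R d a.
Proof.
apply: nondecreasing_cvgn lower_mono _.
by exists ((a 0%N).+1%:R / g 0%N); exact: ub.
Qed.

Lemma point_unit : unit_itv R (address_point R d a).
Proof.
rewrite /unit_itv /= in_itv /=; apply/andP; split.
  by apply: le_trans (point_ge 0%N); rewrite divr_ge0// ltW.
apply: le_trans (point_le 0%N) _.
by case: aP => -> _; rewrite /g /= divr1.
Qed.

(** The point of an address lies in the closed cells of the address; it can be
    their right endpoint only if the next cell is the last child. *)
Lemma cell_point m : (a m.+1 %% d m)%N <> (d m).-1 -> cell d m (address_point R d a) = a m.
Proof.
move=> am; apply/eqP; rewrite step_indexP ?address_lt//; last exact: frac_le.
rewrite point_ge orbT /=; apply/orP; right.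
apply: le_lt_trans (point_le m.+1) _.
rewrite -[ltRHS](grid_fracM R m (a m).+1 d2) ltr_pM2r ?invr_gt0 ?g0// ltr_nat.
case: aP => _ /(_ m) aS.
have dm : (0 < d m)%N := ltnW (d2 m).
rewrite {1}(divn_eq (a m.+1) (d m)) aS mulSnr -addnS ltn_add2l.
have : (a m.+1 %% d m < d m)%N by rewrite ltn_pmod.
rewrite leq_eqVlt => /predU1P[E|//].
by case: am; rewrite -[in RHS]E.
Qed.

End Address.

(** * The symmetric measure on the square *)

Section FiniteVersion.
Context d (T : measurableType d) (R : realType) (m : {measure set T -> \bar R}).

Definition finite_version & fin_num_fun m : set T -> \bar R := m.

Hypothesis mfin : fin_num_fun m.

HB.instance Definition _ := Measure.on (finite_version mfin).
HB.instance Definition _ := Measure_isFinite.Build d T R (finite_version mfin) mfin.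

Lemma finite_measure_of :
  exists m' : {finite_measure set T -> \bar R}, m' = m :> (set T -> \bar R).
Proof. by exists (finite_version mfin). Qed.

End FiniteVersion.

Lemma finite_pushforward d1 d2 (T1 : measurableType d1) (T2 : measurableType d2)
    (R : realType) (nu : {finite_measure set T1 -> \bar R}) (phi : T1 -> T2) :
  measurable_fun setT phi ->
  exists m : {finite_measure set T2 -> \bar R}, m = pushforward nu phi :> (set T2 -> \bar R).
Proof.
move=> mphi.
pose mixin := isMeasurableFun.Build _ _ _ _ _ mphi.
pose f : {mfun T1 >-> T2} := HB.pack phi mixin.
apply: (@finite_measure_of _ T2 R (pushforward nu f)) => U mU.
by apply: fin_num_measure; rewrite -[X in measurable X]setTI; exact: (mphi _ U mU).
Qed.

Lemma finite_measure_add d (T : measurableType d) (R : realType)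
    (m1 m2 : {finite_measure set T -> \bar R}) :
  exists m : {finite_measure set T -> \bar R}, m = measure_add m1 m2 :> (set T -> \bar R).
Proof.
apply: (@finite_measure_of _ T R (measure_add m1 m2)) => U mU.
by rewrite [X in X \is a _](measure_addE m1 m2 U) fin_numD !fin_num_measure.
Qed.

Lemma measurable_point (R : realType) (d : nat -> nat)
    (a : nat -> measurableTypeR R -> nat) :
  (forall m, 1 < d m)%N -> (forall m s, measurable [set t | a m t = s]) ->
  (forall t, address d (a ^~ t)) ->
  measurable_fun setT (fun t => address_point R d (a ^~ t) : measurableTypeR R).
Proof.
move=> d2 ma aP.
apply: (measurable_fun_cvg (h := fun m t => (a m t)%:R / (grid d m)%:R)) => [m|t _].
  exact: (@measurable_nat_comp _ _ _ (measurableTypeR R) (a m)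
    (fun s => s%:R / (grid d m)%:R) setT (ma m)).
exact: point_cvg.
Qed.

(** Symmetry is built in by adding the images under (x, y) and (y, x), which
    spares a uniqueness argument for measures on the square. *)
Lemma address_measure (R : realType) (d : nat -> nat)
    (A : nat -> nat -> nat -> R)
    (nu : {finite_measure set (measurableTypeR R) -> \bar R})
    (a b : nat -> measurableTypeR R -> nat) :
  (forall m, 1 < d m)%N -> address_model d A nu a b ->
  let x (t : measurableTypeR R) : measurableTypeR R := address_point R d (a ^~ t) in
  let y (t : measurableTypeR R) : measurableTypeR R := address_point R d (b ^~ t) in
  exists mu : {finite_measure set (measurableTypeR R * measurableTypeR R)%type
                 -> \bar R},
    [/\ supported_on_square mu, symmetric_measure mu &
      forall g : measurableTypeR R * measurableTypeR R -> R,
        measurable_fun (unit_square R) g ->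
        (forall z, unit_square R z -> 0 <= g z) ->
        (\int[mu]_(z in unit_square R) (g z)%:E =
         \int[nu]_t (g (x t, y t))%:E + \int[nu]_t (g (y t, x t))%:E)%E].
Proof.
move=> d2 [ma mb aP bP _] x y.
have mx := measurable_point d2 ma aP; have my := measurable_point d2 mb bP.
have mxy : measurable_fun setT
    (fun t => (x t, y t) : measurableTypeR R * measurableTypeR R).
  exact: measurable_fun_pair.
have myx : measurable_fun setT
    (fun t => (y t, x t) : measurableTypeR R * measurableTypeR R).
  exact: measurable_fun_pair.
have [m1 m1E] := finite_pushforward nu mxy.
have [m2 m2E] := finite_pushforward nu myx.
have [mu muE] := finite_measure_add m1 m2.
have muA C : mu C = (nu [set t | C (x t, y t)] + nu [set t | C (y t, x t)])%E.
  have -> : mu C = (m1 C + m2 C)%E by rewrite muE; exact: measure_addE.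
  by congr (_ + _)%E; [exact: (congr1 (fun f => f C) m1E)
                      |exact: (congr1 (fun f => f C) m2E)].
have xU t : unit_itv R (x t) by apply: point_unit d2 (aP t).
have yU t : unit_itv R (y t) by apply: point_unit d2 (bP t).
have mU : measurable (unit_square R) by apply: measurableX; exact: measurable_itv.
exists mu; split.
- rewrite /supported_on_square muA.
  rewrite (_ : [set t | _] = set0) ?measure0; last first.
    by apply/seteqP; split => // t; apply; split; [exact: xU | exact: yU].
  rewrite (_ : [set t | _] = set0) ?measure0 ?adde0//.
  by apply/seteqP; split => // t; apply; split; [exact: yU | exact: xU].
- by move=> C mC; rewrite !muA /preimage /= addeC.
- move=> g mg g0; rewrite muE ge0_integral_measure_add//; first last.
  + exact/measurable_EFinP.
  have push (phi : measurableTypeR R -> measurableTypeR R * measurableTypeR R)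
      (m : {finite_measure set (measurableTypeR R * measurableTypeR R)%type -> \bar R}) :
      measurable_fun setT phi -> m = pushforward nu phi :> (set _ -> \bar R) ->
      (forall t, unit_square R (phi t)) ->
      (\int[m]_(z in unit_square R) (g z)%:E = \int[nu]_t (g (phi t))%:E)%E.
    move=> mphi mE phiU; rewrite mE ge0_integral_pushforward//; last 2 first.
    + exact/measurable_EFinP.
    + by move=> z; rewrite inE => Uz; rewrite lee_fin g0.
    by congr (integral _ _ _); apply/seteqP; split => // t _; exact: phiU.
  rewrite (push _ _ mxy m1E) ?(push _ _ myx m2E)// => t; split;
    by [exact: xU | exact: yU].
Qed.

(** * Approximation by grid sets *)

Definition grid_error (R : realType) (d : nat -> nat) (B : set (measurableTypeR R))
    (m : nat) (G : set nat) : set (measurableTypeR R) :=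
  unit_itv R `&` ((B `\` cell d m @^-1` G) `|` (cell d m @^-1` G `\` B)).

Definition grid_approximable (R : realType) (d : nat -> nat)
    (rho : set (measurableTypeR R) -> \bar R) (B : set (measurableTypeR R)) : Prop :=
  forall eps : R, 0 < eps -> exists m0, forall m, (m0 <= m)%N ->
    exists G, (rho (grid_error d B m G) <= eps%:E)%E.

(** The approximable sets form a sigma-algebra that contains the open rays, hence
    all Borel sets.  The measure rho is arbitrary: Lebesgue density arguments
    would not cover the singular marginals to which this is applied. *)
Section GridApprox.
Context {R : realType} {d : nat -> nat}
  {rho : {finite_measure set (measurableTypeR R) -> \bar R}}.
Hypothesis d2 : forall m, (1 < d m)%N.

Let mU : measurable (unit_itv R). Proof. exact: measurable_itv. Qed.

Let mcell m (G : set nat) : measurable (cell d m @^-1` G : set (measurableTypeR R)).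
Proof.
have := @measurable_nat_comp _ _ _ nat (cell d m) id setT
  (fun s => @measurable_cell R d m s d2).
by move=> /(_ measurableT G I); rewrite setTI.
Qed.

Lemma measurable_grid_error (B : set (measurableTypeR R)) m G :
  measurable B -> measurable (grid_error d B m G).
Proof.
by move=> mB; apply: measurableI => //; apply: measurableU; apply: measurableD.
Qed.

Let approx_ray (c : R) : grid_approximable d rho (`]c, +oo[%classic).
Proof.
move=> eps e0.
pose H m : set (measurableTypeR R) := `]c, c + m.+1%:R^-1]%classic.
have mH m : measurable (H m) by exact: measurable_itv.
have Hdec m l : (m <= l)%N -> H l `<=` H m.
  move=> ml t; rewrite /H /= !in_itv /= => /andP[-> h] /=; apply: le_trans h _.
  by rewrite lerD2l lef_pV2 ?posrE// ler_nat.
have H0 : \bigcap_m H m = set0.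
  apply/seteqP; split => // t Ht.
  have ct : c < t by have := Ht 0%N I; rewrite /H /= in_itv /= => /andP[].
  have tc0 : 0 < t - c by rewrite subr_gt0.
  have := Ht (Num.truncn (t - c)^-1) I; rewrite /H /= in_itv /= => /andP[_].
  apply/negP; rewrite -ltNge -ltrBrDl.
  by rewrite -[ltRHS]invrK ltf_pV2 ?posrE ?invr_gt0// truncnS_gt.
(* only points of ]c, c + 1 / (m + 1)] can be misplaced at level m *)
have cvgH : (rho \o H) m @[m --> \oo] --> 0%E.
  rewrite -(measure0 rho) -H0; apply: nonincreasing_cvg_mu => //.
  - by rewrite ltey_eq fin_num_measure.
  - by rewrite H0.
  - by move=> m l ml; apply/subsetPset; exact: Hdec.
have [m0 _ Hm0] : \forall m \near \oo, (rho (H m) < eps%:E)%E.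
  have lt0 : (0 < eps%:E)%E by rewrite lte_fin.
  exact: cvgH (open_ereal_lt' lt0).
exists m0 => m mm0; exists [set s | c < s%:R / (grid d m)%:R].
apply: le_trans (ltW (Hm0 m mm0)).
apply: le_measure; rewrite ?inE; [exact: measurable_grid_error (measurable_itv _) | exact: mH |].
have g0 : 0 < (grid d m)%:R :> R by rewrite ltr0n grid_gt0.
move=> t [/= Ut].
have /andP[h1 h2] := cell_bounds m d2 Ut.
rewrite /H /= !in_itv /= andbT => -[[ct /negP nG]|[cG /negP]]; last first.
  rewrite -leNgt => tc; exfalso.
  by have := lt_le_trans (lt_le_trans cG h1) tc; rewrite ltxx.
rewrite ct /=; rewrite -leNgt in nG.
apply: le_trans h2 _; rewrite -natr1 mulrDl mul1r lerD// lef_pV2 ?posrE//.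
by rewrite ler_nat grid_ge.
Qed.

Let approx_setC (B : set (measurableTypeR R)) :
  grid_approximable d rho B -> grid_approximable d rho (~` B).
Proof.
move=> aB eps e0; have [m0 H] := aB eps e0; exists m0 => m mm0.
have [G HG] := H m mm0; exists (~` G); apply: le_trans HG.
rewrite le_eqVlt; apply/orP; left; apply/eqP; congr (rho _).
rewrite /grid_error preimage_setC; congr (_ `&` _).
by rewrite !setDE !setCK setUC [in RHS]setIC [X in _ `|` X = _]setIC setUC.
Qed.

Let approx_setU (B1 B2 : set (measurableTypeR R)) : measurable B1 -> measurable B2 ->
  grid_approximable d rho B1 -> grid_approximable d rho B2 ->
  grid_approximable d rho (B1 `|` B2).
Proof.
move=> mB1 mB2 a1 a2 eps e0.
have e2 : 0 < eps / 2 by rewrite divr_gt0.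
have [m1 H1] := a1 _ e2; have [m2 H2] := a2 _ e2.
exists (maxn m1 m2) => m; rewrite geq_max => /andP[/H1[G1 {}H1] /H2[G2 {}H2]].
exists (G1 `|` G2).
rewrite [eps]splitr EFinD; apply: le_trans (leeD H1 H2).
have m12 := measurableU _ _ (measurable_grid_error m G1 mB1) (measurable_grid_error m G2 mB2).
apply: le_trans (measureU2 _ _ _); [|exact: measurable_grid_error..].
apply: le_measure; rewrite ?inE//; first by apply: measurable_grid_error; exact: measurableU.
move=> t [Ut] [[[h|h] /not_orP[n1 n2]]|[[h|h] /not_orP[n1 n2]]].
- by left; split => //; left.
- by right; split => //; left.
- by left; split => //; right.
- by right; split => //; right.
Qed.

Let approx_bigcup (B : nat -> set (measurableTypeR R)) :
  (forall k, measurable (B k)) -> (forall k, grid_approximable d rho (B k)) ->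
  grid_approximable d rho (\bigcup_k B k).
Proof.
move=> mB aB eps e0.
pose C N := \big[setU/set0]_(k < N) B k.
have mC N : measurable (C N) by apply: bigsetU_measurable.
have aC N : grid_approximable d rho (C N).
  elim: N => [|N IH].
    move=> e ep; exists 0%N => m _; exists set0.
    by rewrite /C big_ord0 /grid_error preimage_set0 setDv setU0 setI0 measure0; exact: ltW.
  by rewrite /C big_ord_recr; exact: approx_setU (mC N) (mB N) IH (aB N).
pose D N := (\bigcup_k B k) `\` C N.
have mBB : measurable (\bigcup_k B k) by exact: bigcupT_measurable.
have mD N : measurable (D N) by exact: measurableD.
have D0 : \bigcap_N D N = set0.
  apply/seteqP; split => // t Dt.
  have [[k _ Bk] _] := Dt 0%N I.
  have [_] := Dt k.+1 I; apply.
  by rewrite /C big_ord_recr; right.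
have cvgD0 : (rho \o D) N @[N --> \oo] --> 0%E.
  rewrite -(measure0 rho) -D0; apply: nonincreasing_cvg_mu => //.
  - by rewrite ltey_eq fin_num_measure.
  - by rewrite D0.
  - apply/nonincreasing_seqP => N; apply/subsetPset => t [Bt nC]; split => // Ct.
    by apply: nC; rewrite /C big_ord_recr; left.
have e2 : 0 < eps / 2 by rewrite divr_gt0.
have [N _ HN] : \forall N \near \oo, (rho (D N) < (eps / 2)%:E)%E.
  have lt0 : (0 < (eps / 2)%:E)%E by rewrite lte_fin.
  exact: cvgD0 (open_ereal_lt' lt0).
have {}HN := HN N (leqnn N).
have [m0 H] := aC N _ e2; exists m0 => m /H[G HG]; exists G.
rewrite [eps]splitr EFinD; apply: le_trans (leeD (ltW HN) HG).
apply: le_trans (measureU2 _ _ _); [|exact: mD|exact: measurable_grid_error].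
apply: le_measure; rewrite ?inE; [exact: measurable_grid_error | |].
  by apply: measurableU => //; exact: measurable_grid_error.
move=> t [Ut [[Bt nG]|[Gt nB]]].
  have [Ct|nC] := pselect (C N t); [right | by left].
  by split => //; left.
right; split => //; right; split => // Ct; apply: nB.
by move: Ct; rewrite /C -bigcup_mkord => -[k _ Bk]; exists k.
Qed.

Lemma grid_approx (B : set (measurableTypeR R)) :
  measurable B -> grid_approximable d rho B.
Proof.
move=> mB; suff : measurable B /\ grid_approximable d rho B by case.
have : (@RGenOInfty.G R).-sigma.-measurable B by rewrite -RGenOInfty.measurableE.
apply: (@smallest_sub _ (sigma_algebra setT) (@RGenOInfty.G R)
  [set B | measurable (B : set (measurableTypeR R)) /\ grid_approximable d rho B]).
  split=> [|C [mC aC]|C HC].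
  - split => // e e0; exists 0%N => m _; exists set0.
    by rewrite /grid_error preimage_set0 setDv setU0 setI0 measure0; exact: ltW.
  - by rewrite setTD; split; [exact: measurableC | exact: approx_setC].
  - split; first by apply: bigcupT_measurable => k; case: (HC k).
    by apply: approx_bigcup => k; case: (HC k).
by move=> _ [c ->]; split; [exact: measurable_itv | exact: approx_ray].
Qed.

End GridApprox.

(** The version for finitely valued maps: a value T' s is chosen among the i whose
    approximating grid set contains s, and T differs from T' only where one of
    the approximations is wrong. *)
Lemma finite_grid_approx (R : realType) (d : nat -> nat)
    (rho : {finite_measure set (measurableTypeR R) -> \bar R})
    (I : finType) (T : measurableTypeR R -> I) (eps : R) :
  (forall m, 1 < d m)%N -> (forall i, measurable [set x | T x = i]) -> 0 < eps ->
  exists m0, forall m, (m0 <= m)%N -> exists T' : nat -> I,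
    measurable [set x | T x <> T' (cell d m x)] /\
    (rho (unit_itv R `&` [set x | T x <> T' (cell d m x)]) <= eps%:E)%E.
Proof.
move=> d2 mT e0.
pose e := eps / #|I|.+1%:R.
have ep : 0 < e by rewrite divr_gt0.
have /choice [M HM] := fun i => grid_approx (rho := rho) d2 (mT i) ep.
exists (\max_i M i) => m Mm.
have /choice [G HG] : forall i, exists G, (rho (grid_error d [set x | T x = i] m G) <= e%:E)%E.
  by move=> i; apply: HM; apply: leq_trans Mm; exact: leq_bigmax.
(* any value of T will do for cells outside all approximating sets *)
pose i0 := T (0 : R).
pose T' s := odflt i0 [pick i | `[< G i s >]].
pose i_ k := nth i0 (enum I) k.
pose F k := grid_error d [set x | T x = i_ k] m (G (i_ k)).
have mE : measurable [set x | T x <> T' (cell d m x)].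
  rewrite [X in measurable X](_ : _ =
    \bigcup_s ([set x | cell d m x = s] `&` ~` [set x | T x = T' s])).
    apply: bigcupT_measurable => s; apply: measurableI; first exact: measurable_cell.
    exact: measurableC.
  by apply/seteqP; split=> [x h|x [s _ [/= <-]]]; [exists (cell d m x)|].
exists T'; split => //.
apply: (@le_trans _ _ (\sum_(k < #|I|) e%:E)%E); last first.
  rewrite sumEFin lee_fin sumr_const card_ord -[_ *+ _]mulr_natr /e mulrAC ler_pdivrMr//.
  by rewrite ler_wpM2l ?(ltW e0)// ler_nat.
apply: (@le_trans _ _ (\sum_(k < #|I|) rho (F k))%E); last first.
  by apply: lee_sum => k _; exact: HG.
apply: (@content_subadditive _ _ _ rho _ F).
- by move=> k _; exact: measurable_grid_error.
- by apply: measurableI => //; exact: measurable_itv.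
move=> x [Ux nT]; rewrite -(bigcup_mkord _ F).
have iE i : exists2 k, (k < #|I|)%N & i_ k = i.
  exists (index i (enum I)); first by rewrite cardE index_mem mem_enum.
  by rewrite /i_ nth_index ?mem_enum.
have [GT|nGT] := pselect (G (T x) (cell d m x)); last first.
  have [k kI kE] := iE (T x); exists k => //; split => //; left; rewrite kE; split => //.
move: nT; rewrite /T' /=; case: pickP => [i /asboolP Gi /= nT|/(_ (T x))]; last first.
  by move=> /asboolP.
have [k kI kE] := iE i; exists k => //; split => //; right; rewrite kE; split => //.
Qed.

(** * Quotients of the measure and of the array *)

(** The quotient of mu by f, computed in the space of addresses. *)
Definition model_quotient (R : realType) (d : nat -> nat)
    (nu : {finite_measure set (measurableTypeR R) -> \bar R})
    (a b : nat -> measurableTypeR R -> nat) (j : nat)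
    (f : 'I_j -> measurableTypeR R -> R) : 'M[R]_j :=
  \matrix_(i, i')
    (\int[nu]_t (f i (address_point R d (a ^~ t)) * f i' (address_point R d (b ^~ t))) +
     \int[nu]_t (f i (address_point R d (b ^~ t)) * f i' (address_point R d (a ^~ t)))).

Definition last_children (R : realType) (d : nat -> nat)
    (a b : nat -> measurableTypeR R -> nat) (m : nat) : set (measurableTypeR R) :=
  [set t | (a m.+1 t %% d m)%N = (d m).-1] `|`
  [set t | (b m.+1 t %% d m)%N = (d m).-1].

Section Model.
Context {R : realType} {d : nat -> nat} {A : nat -> nat -> nat -> R}
  {nu : {finite_measure set (measurableTypeR R) -> \bar R}}
  {a b : nat -> measurableTypeR R -> nat}.
Hypotheses (d2 : forall m, (1 < d m)%N) (Acoh : coherent_array d A)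
  (model : address_model d A nu a b).

Let x (t : measurableTypeR R) : measurableTypeR R := address_point R d (a ^~ t).
Let y (t : measurableTypeR R) : measurableTypeR R := address_point R d (b ^~ t).

Let ma m s : measurable [set t | a m t = s]. Proof. by case: model. Qed.
Let mb m s : measurable [set t | b m t = s]. Proof. by case: model. Qed.
Let aP t : address d (a ^~ t). Proof. by case: model. Qed.
Let bP t : address d (b ^~ t). Proof. by case: model. Qed.
Let mx : measurable_fun setT x. Proof. exact: measurable_point. Qed.
Let my : measurable_fun setT y. Proof. exact: measurable_point. Qed.
Let xU t : unit_itv R (x t). Proof. exact: point_unit d2 (aP t). Qed.
Let yU t : unit_itv R (y t). Proof. exact: point_unit d2 (bP t). Qed.
Let mU : measurable (unit_itv R). Proof. exact: measurable_itv. Qed.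
Let nu_fin : (nu setT < +oo)%E. Proof. by rewrite ltey_eq fin_num_measure. Qed.

Let measurable_comp_x (f : measurableTypeR R -> R) :
  measurable_fun (unit_itv R) f -> measurable_fun setT (f \o x).
Proof. by move=> mf; apply: measurable_comp mf mx => // _ [t _ <-]. Qed.

Let measurable_comp_y (f : measurableTypeR R -> R) :
  measurable_fun (unit_itv R) f -> measurable_fun setT (f \o y).
Proof. by move=> mf; apply: measurable_comp mf my => // _ [t _ <-]. Qed.

Let ma_comp m (h : nat -> R) : measurable_fun setT (fun t => h (a m t)).
Proof. exact: (@measurable_nat_comp _ _ _ (measurableTypeR R) (a m) h setT (ma m)). Qed.

Let mb_comp m (h : nat -> R) : measurable_fun setT (fun t => h (b m t)).
Proof. exact: (@measurable_nat_comp _ _ _ (measurableTypeR R) (b m) h setT (mb m)). Qed.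

Let mlast (c : nat -> measurableTypeR R -> nat) m :
  (forall m s, measurable [set t | c m t = s]) ->
  measurable [set t | (c m.+1 t %% d m)%N = (d m).-1].
Proof.
move=> mc; have := @measurable_nat_comp _ _ _ nat (c m.+1) (fun s => s %% d m)%N setT (mc m.+1).
by move=> /(_ measurableT [set (d m).-1] I); rewrite setTI.
Qed.

Lemma measurable_last_children m : measurable (last_children d a b m).
Proof. by apply: measurableU; exact: mlast. Qed.

(** The condition on the first address selects the last row in each block of rows
    of A_(m+1), the condition on the second one the last columns; symmetry of
    the array reduces the second to the first. *)
Lemma last_children_mass m : (nu (last_children d a b m) <= (m.+1%:R^-1)%:E)%E.
Proof.
have [A0 Asym _ Alast] := Acoh; have [_ _ _ _ int] := model.
have half h (c : nat -> measurableTypeR R -> nat) :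
    measurable [set t | (c m.+1 t %% d m)%N = (d m).-1] ->
    (forall t, h (a m.+1 t) (b m.+1 t) = ((c m.+1 t %% d m)%N == (d m).-1)%:R) ->
    (forall p q, 0 <= h p q) ->
    \sum_(p < grid d m.+1) \sum_(q < grid d m.+1) h p q * (A m.+1 p q / 2) =
    (\sum_(p < grid d m) \sum_(q < grid d m.+1) A m.+1 (p * d m + (d m).-1)%N q) / 2 ->
    (nu [set t | (c m.+1 t %% d m)%N = (d m).-1] <= (m.+1%:R^-1 / 2)%:E)%E.
  move=> mc hc h0 hE.
  rewrite -[X in nu X]setIT -integral_indic//.
  rewrite (_ : (\int[nu]_t _)%E = (\int[nu]_t (h (a m.+1 t) (b m.+1 t))%:E)%E).
    by rewrite int// hE lee_fin ler_wpM2r ?invr_ge0.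
  apply: eq_integral => t _; rewrite hc indicE; congr (_%:R)%:E; congr nat_of_bool.
  by apply/idP/eqP; rewrite inE.
have d0 : (0 < d m)%N := ltnW (d2 m).
have pick_last (F : nat -> R) : \sum_(p < grid d m.+1) ((p %% d m)%N == (d m).-1)%:R * F p =
    \sum_(p < grid d m) F (p * d m + (d m).-1)%N :> R.
  rewrite (sum_ord_mul _ _ (fun p => ((p %% d m)%N == (d m).-1)%:R * F p)).
  apply: eq_bigr => p _.
  have l : ((d m).-1 < d m)%N by rewrite prednK.
  rewrite (bigD1 (Ordinal l))//= modnMDl modn_small// eqxx mul1r big1 ?addr0// => u ul.
  rewrite modnMDl modn_small//; case: eqP; rewrite ?mul0r// => E.
  by move: ul; rewrite -val_eqE /= E eqxx.
rewrite [m.+1%:R^-1]splitr EFinD.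
apply: le_trans (measureU2 _ _ _) _; [exact: mlast | exact: mlast |].
apply: leeD.
  apply: (half (fun p q => ((p %% d m)%N == (d m).-1)%:R) a) => //; first exact: mlast.
  rewrite -(pick_last (fun p => \sum_(q < grid d m.+1) A m.+1 p q)) mulr_suml.
  apply: eq_bigr => p _; rewrite -mulrA mulr_suml mulr_sumr.
  by apply: eq_bigr.
apply: (half (fun p q => ((q %% d m)%N == (d m).-1)%:R) b) => //; first exact: mlast.
rewrite exchange_big /=.
rewrite -(pick_last (fun p => \sum_(q < grid d m.+1) A m.+1 p q)) mulr_suml.
apply: eq_bigr => p _; rewrite -mulrA mulr_suml mulr_sumr.
by apply: eq_bigr => q _; rewrite Asym.
Qed.

Lemma cell_of_address m t : ~ last_children d a b m t ->
  cell d m (x t) = a m t /\ cell d m (y t) = b m t.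
Proof.
by move=> /not_orP[na nb]; split; [exact: (cell_point d2 (aP t)) | exact: (cell_point d2 (bP t))].
Qed.

Lemma total_mass m : gamma (array_mx d A m) = 2 * fine (nu setT).
Proof.
have [_ _ _ _ int] := model.
have := int m (fun _ _ => 1) (fun _ _ => ler01).
rewrite integral_cst// mul1e => ->; rewrite /= /gamma mulr_sumr.
apply: eq_bigr => p _; rewrite mulr_sumr; apply: eq_bigr => q _.
by rewrite mxE mul1r mulrC divfK.
Qed.

Let mul01 (r s : R) : 0 <= r <= 1 -> 0 <= s <= 1 -> 0 <= r * s <= 1.
Proof.
move=> /andP[r0 r1] /andP[s0 s1]; rewrite mulr_ge0//=.
by rewrite -[leRHS]mulr1 ler_pM.
Qed.

(** Both quotients are integrals over the space of addresses: that of A_m is the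
    integral of Q i (a m t) * Q i' (b m t) plus the one with a and b exchanged,
    so they are compared integrand by integrand. *)
Lemma model_quotient_dist (j m : nat) (f : 'I_j -> measurableTypeR R -> R)
    (Q : 'I_j -> nat -> R) (E : set (measurableTypeR R)) (eta : R) :
  (forall i, measurable_fun (unit_itv R) (f i)) ->
  (forall i z, unit_itv R z -> 0 <= f i z <= 1) -> (forall i s, 0 <= Q i s <= 1) ->
  measurable E -> 0 <= eta ->
  (forall i t, ~ E t -> `|f i (x t) - Q i (a m t)| <= eta /\
                        `|f i (y t) - Q i (b m t)| <= eta) ->
  forall i i', `|model_quotient d nu a b f i i' -
    \sum_(p < grid d m) \sum_(q < grid d m) Q i p * A m p q * Q i' q| <=
    2 * (2 * eta * fine (nu setT) + fine (nu E)).
Proof.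
move=> mf f01 Q01 mE eta0 fQ i i'.
have [A0 Asym _ _] := Acoh; have [_ _ _ _ int] := model.
have Q0 l s : 0 <= Q l s by case/andP: (Q01 l s).
have prod_dist (u v u' v' : R) : 0 <= u <= 1 -> 0 <= v' <= 1 ->
    `|u - u'| <= eta -> `|v - v'| <= eta -> `|u * v - u' * v'| <= 2 * eta.
  move=> /andP[u0 u1] /andP[v0 v1] h1 h2.
  have -> : u * v - u' * v' = u * (v - v') + (u - u') * v' by ring.
  apply: le_trans (ler_normD _ _) _; rewrite !normrM (ger0_norm u0) (ger0_norm v0).
  rewrite mulr_natl mulr2n; apply: lerD.
    by rewrite -[leRHS]mul1r ler_pM.
  by rewrite -[leRHS]mulr1 ler_pM.
have est (u v u' v' : measurableTypeR R -> R) :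
    measurable_fun setT u -> measurable_fun setT v ->
    measurable_fun setT u' -> measurable_fun setT v' ->
    (forall t, 0 <= u t <= 1) -> (forall t, 0 <= v t <= 1) ->
    (forall t, 0 <= u' t <= 1) -> (forall t, 0 <= v' t <= 1) ->
    (forall t, ~ E t -> `|u t - u' t| <= eta) ->
    (forall t, ~ E t -> `|v t - v' t| <= eta) ->
    `|\int[nu]_t (u t * v t) - \int[nu]_t (u' t * v' t)| <=
    2 * eta * fine (nu setT) + fine (nu E).
  move=> mu mv mu' mv' u01 v01 u01' v01' uu' vv'.
  have := @Rintegral_dist_le _ _ R nu setT E (fun t => u t * v t) (fun t => u' t * v' t)
    (2 * eta) measurableT mE nu_fin.
  rewrite setTI; apply.
  - exact: measurable_funM.
  - exact: measurable_funM.
  - by move=> t _; apply: mul01.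
  - by move=> t _; apply: mul01.
  - by rewrite mulr_ge0.
  - by move=> t _ nE; apply: prod_dist => //; [exact: uu' | exact: vv'].
have int1 : \int[nu]_t (Q i (a m t) * Q i' (b m t)) =
    \sum_(p < grid d m) \sum_(q < grid d m) Q i p * Q i' q * (A m p q / 2).
  by rewrite /Rintegral (int m (fun p q => Q i p * Q i' q))// => p q; rewrite mulr_ge0.
have int2 : \int[nu]_t (Q i (b m t) * Q i' (a m t)) =
    \sum_(p < grid d m) \sum_(q < grid d m) Q i p * Q i' q * (A m p q / 2).
  rewrite /Rintegral (int m (fun p q => Q i q * Q i' p))/= => [|p q]; last by rewrite mulr_ge0.
  by rewrite exchange_big /=; apply: eq_bigr => p _; apply: eq_bigr => q _; rewrite Asym.
have -> : \sum_(p < grid d m) \sum_(q < grid d m) Q i p * A m p q * Q i' q =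
    \int[nu]_t (Q i (a m t) * Q i' (b m t)) + \int[nu]_t (Q i (b m t) * Q i' (a m t)).
  rewrite int1 int2 -big_split /=; apply: eq_bigr => p _.
  by rewrite -big_split /=; apply: eq_bigr => q _; field.
rewrite mxE opprD addrACA; apply: le_trans (ler_normD _ _) _.
rewrite mulr_natl mulr2n; apply: lerD; apply: est.
all: try exact: measurable_comp_x (mf _).
all: try exact: measurable_comp_y (mf _).
all: try exact: ma_comp.
all: try exact: mb_comp.
all: try by move=> t; exact: Q01.
all: try by move=> t; exact: f01 (xU t).
all: try by move=> t; exact: f01 (yU t).
- by move=> t nE; case: (fQ i t nE).
- by move=> t nE; case: (fQ i' t nE).
- by move=> t nE; case: (fQ i t nE).
- by move=> t nE; case: (fQ i' t nE).
Qed.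

End Model.

Lemma balanced_le1 (R : realType) (k : nat) (f : 'I_k -> measurableTypeR R -> R) :
  balanced_partition_of_unity f -> forall i z, unit_itv R z -> 0 <= f i z <= 1.
Proof.
move=> [_ f0 f1 _] i z Uz; rewrite f0//= -(f1 _ Uz) (bigD1 i)//= lerDl.
by apply: sumr_ge0 => i' _; exact: f0.
Qed.

Lemma l1_dist_le (R : realType) (k : nat) (X Y : 'M[R]_k) (e : R) :
  (forall i j, `|X i j - Y i j| <= e) -> l1_dist X Y <= k%:R ^+ 2 * e.
Proof.
move=> XY; apply: (@le_trans _ _ (\sum_(i < k) \sum_(j < k) e)).
  by apply: ler_sum => i _; apply: ler_sum.
under eq_bigr do rewrite sumr_const card_ord.
by rewrite sumr_const card_ord -[_ *+ _]mulr_natl -[e *+ _]mulr_natl mulrA expr2.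
Qed.

Section Directions.
Context {R : realType} {d : nat -> nat} {A : nat -> nat -> nat -> R}
  {nu : {finite_measure set (measurableTypeR R) -> \bar R}}
  {a b : nat -> measurableTypeR R -> nat}.
Hypotheses (d2 : forall m, (1 < d m)%N) (Acoh : coherent_array d A)
  (model : address_model d A nu a b).

Let x (t : measurableTypeR R) : measurableTypeR R := address_point R d (a ^~ t).
Let y (t : measurableTypeR R) : measurableTypeR R := address_point R d (b ^~ t).
Let mx : measurable_fun setT x.
Proof. by case: model => *; exact: measurable_point. Qed.
Let my : measurable_fun setT y.
Proof. by case: model => *; exact: measurable_point. Qed.
Let xU t : unit_itv R (x t).
Proof. by case: model => _ _ aP _ _; exact: point_unit d2 (aP t). Qed.
Let yU t : unit_itv R (y t).
Proof. by case: model => _ _ _ bP _; exact: point_unit d2 (bP t). Qed.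
Let mU : measurable (unit_itv R). Proof. exact: measurable_itv. Qed.
Let leb := @lebesgue_measure R.
Let lebU : leb (unit_itv R) = 1%E.
Proof. by rewrite /leb /unit_itv lebesgue_measure_itv /= lte_fin ltr01 -EFinB subr0. Qed.
Let last_fin m : fine (nu (last_children d a b m)) <= m.+1%:R^-1.
Proof.
rewrite -lee_fin fineK ?(last_children_mass d2 Acoh model)//.
apply: fin_num_measure; exact: measurable_last_children model m.
Qed.

(** The step functions z |-> P i (cell of z) are balanced because all cells have
    the same length; they agree with P at the address of t unless t is in
    [last_children]. *)
Lemma grid_partition_quotient (j m : nat) (P : 'M[R]_(j, grid d m)) :
  (0 < j)%N -> fractional_partition R j (grid d m) P ->
  exists2 f, balanced_partition_of_unity f &
    l1_dist (model_quotient d nu a b f) (P *m array_mx d A m *m P^T) <=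
    j%:R ^+ 2 * (2 * m.+1%:R^-1).
Proof.
move=> j0 [P0 Pr Pc].
pose Q i s : R := oapp (P i) 0 (insub s).
have QP i (s : 'I_(grid d m)) : Q i s = P i s by rewrite /Q valK.
have Pc1 i s : P i s <= 1.
  by rewrite -(Pc s) (bigD1 i)//= lerDl sumr_ge0.
have Q01 i s : 0 <= Q i s <= 1.
  by rewrite /Q; case: insub => [s'|] /=; rewrite ?lexx ?ler01 // P0 Pc1.
have mQ i : measurable_fun (unit_itv R) (fun z => Q i (cell d m z)).
  exact: (@measurable_nat_comp _ _ _ (measurableTypeR R) (cell d m) (Q i) _
    (fun s => @measurable_cell R d m s d2)).
exists (fun i z => Q i (cell d m z)).
  split => //.
  - by move=> i z _; case/andP: (Q01 i (cell d m z)).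
  - move=> z _; rewrite -(Pc (Ordinal (cell_lt m z d2))).
    by apply: eq_bigr => i _; rewrite -QP.
  - move=> i; rewrite (integral_cell m d2 (h := Q i)); last first.
      by move=> s; case/andP: (Q01 i s).
    congr EFin; under eq_bigr do rewrite QP.
    by rewrite Pr mulrAC divff ?mul1r// pnatr_eq0 -lt0n grid_gt0.
apply: l1_dist_le => i i'; rewrite quotient_entry.
have -> : \sum_(v < grid d m) \sum_(w < grid d m) P i v * array_mx d A m v w * P i' w =
    \sum_(p < grid d m) \sum_(q < grid d m) Q i p * A m p q * Q i' q.
  by apply: eq_bigr => p _; apply: eq_bigr => q _; rewrite !QP mxE.
apply: le_trans (model_quotient_dist d2 Acoh model (E := last_children d a b m) (eta := 0)
  mQ _ Q01 _ _ _ i i') _ => //.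
- exact: measurable_last_children model m.
- by move=> l t nl; have [-> ->] := cell_of_address d2 model nl; rewrite !subrr normr0.
- by rewrite mulr0 mul0r add0r ler_wpM2l.
Qed.

(** One finite measure dominating Lebesgue measure on the unit interval and the
    laws of the two points. *)
Let combined : exists rho : {finite_measure set (measurableTypeR R) -> \bar R},
  forall C, measurable C -> [/\ (leb (C `&` unit_itv R) <= rho C)%E,
    (nu (x @^-1` C) <= rho C)%E & (nu (y @^-1` C) <= rho C)%E].
Proof.
have Uoo : (leb (unit_itv R) < +oo)%E by rewrite lebU ltry.
have [px pxE] := finite_pushforward nu mx.
have [py pyE] := finite_pushforward nu my.
have [p pE] := finite_measure_add px py.
have [rho rhoE] := finite_measure_add (mfrestr mU Uoo) p.
exists rho => C mC.
have -> : rho C = (leb (C `&` unit_itv R) + (nu (x @^-1` C) + nu (y @^-1` C)))%E.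
  have -> : rho C = (mfrestr mU Uoo C + p C)%E by rewrite rhoE; exact: measure_addE.
  have -> : p C = (px C + py C)%E by rewrite pE; exact: measure_addE.
  congr (_ + _)%E; congr (_ + _)%E.
    exact: (congr1 (fun f => f C) pxE).
  exact: (congr1 (fun f => f C) pyE).
have h0 : (0 <= leb (C `&` unit_itv R))%E by [].
have h1 : (0 <= nu (x @^-1` C))%E by [].
have h2 : (0 <= nu (y @^-1` C))%E by [].
split.
- by rewrite leeDl// adde_ge0.
- by apply: (@le_trans _ _ (nu (x @^-1` C) + nu (y @^-1` C))%E); rewrite ?leeDl ?leeDr.
- by apply: (@le_trans _ _ (nu (x @^-1` C) + nu (y @^-1` C))%E); rewrite ?leeDr.
Qed.

(** The values of f are rounded down to multiples of 1 / q; each class of the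
    resulting finite partition is represented by a point of the interval, so
    the discretized functions still sum to 1. *)
Let discretize (j : nat) (f : 'I_j -> measurableTypeR R -> R) (tau : R) :
  balanced_partition_of_unity f -> 0 < tau ->
  exists (I : finType) (T : measurableTypeR R -> I) (rep : I -> measurableTypeR R),
    [/\ forall c, measurable [set z | T z = c], forall c, unit_itv R (rep c) &
        forall i z, unit_itv R z -> `|f i z - f i (rep (T z))| <= tau].
Proof.
move=> fB t0; have [mf _ _ _] := fB.
pose q := (Num.truncn tau^-1).+1.
have qt : q%:R^-1 <= tau.
  by rewrite -[leRHS]invrK lef_pV2 ?posrE ?invr_gt0// ltW// truncnS_gt.
pose g i : measurableTypeR R -> R := f i \_ (unit_itv R).
have mg i : measurable_fun setT (g i) by apply/(measurable_restrictT _ mU); exact: mf.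
pose lev i z := step_index (fun s => s%:R / q%:R : R) q (g i z).
have levq i z : (lev i z < q)%N by exact: step_index_lt.
pose T z : {ffun 'I_j -> 'I_q} := [ffun i => inord (lev i z)].
have zU : unit_itv R (0 : R) by rewrite /unit_itv /= in_itv /= lexx ler01.
pose rep c : measurableTypeR R := xget (0 : R) [set z | unit_itv R z /\ T z = c].
exists {ffun 'I_j -> 'I_q}, T, rep; split.
- move=> c.
  have -> : [set z | T z = c] = \bigcap_(i in [set: 'I_j]) [set z | lev i z = c i].
    apply/seteqP; split => z /=.
      by move=> <- i _ /=; rewrite ffunE inordK.
    move=> h; apply/ffunP => i; apply: val_inj; rewrite ffunE /= inordK//.
    exact: h i I.
  apply: fin_bigcap_measurable => // i _.
  have := mg i measurableT _ (measurable_step_fiber (c i) (@frac_le R q) (ltn0Sn _)).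
  by move=> /(_ (Num.truncn tau^-1)); rewrite setTI.
- by move=> c; rewrite /rep; case: xgetP => [z _ []|_].
move=> i z Uz; rewrite /rep.
case: xgetP => [w _ [Uw Tw]|no]; last by have := no z; case.
have lw : lev i w = lev i z.
  by have /ffunP/(_ i)/(congr1 val) := Tw; rewrite !ffunE /= !inordK.
have gE v : unit_itv R v -> g i v = f i v by move=> Uv; rewrite /g patchE mem_set.
have bnd v : unit_itv R v -> (lev i v)%:R / q%:R <= f i v <= (lev i v).+1%:R / q%:R.
  move=> Uv; rewrite -gE//; apply: step_frac_bounds => //.
  rewrite gE//; have := balanced_le1 fB i Uv.
  by rewrite /unit_itv /= in_itv.
move: (bnd z Uz) (bnd w Uw); rewrite lw -natr1 mulrDl mul1r.
by move=> /andP[? ?] /andP[? ?]; rewrite ler_norml; lra.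
Qed.

(** Off a set of small measure, f is within tau of the matrix Q obtained from the
    discretization of f by evaluating it on grid cells.  The columns of Q are
    values of f and so sum to 1; its row sums are compared with the integrals
    of f for Lebesgue measure, and [balance_rows] makes them exact. *)
Lemma partition_grid_quotient (j : nat) (f : 'I_j -> measurableTypeR R -> R) (eps : R) :
  (0 < j)%N -> balanced_partition_of_unity f -> 0 < eps ->
  exists m, exists2 P, fractional_partition R j (grid d m) P &
    l1_dist (model_quotient d nu a b f) (P *m array_mx d A m *m P^T) <= eps.
Proof.
move=> j0 fB e0; have [mf f0 f1 fint] := fB.
have f01 := balanced_le1 fB.
pose J : R := j%:R.
have J0 : 0 < J by rewrite ltr0n.
pose N := fine (nu setT).
have N0 : 0 <= N by rewrite fine_ge0.
(* tau * K collects all errors proportional to tau *)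
pose K := J ^+ 2 * (4 * N + 4) + 16 * J * N.
have K0 : 0 < K.
  by rewrite ltr_wpDr ?mulr_ge0 ?(ltW J0)// mulr_gt0 ?exprn_gt0// ltr_wpDl// mulr_ge0.
have [tau [t0 tJ tK]] : exists tau : R, [/\ 0 < tau, J * (2 * tau) <= 1 & tau * K <= eps / 2].
  exists (Num.min (J * 2)^-1 (eps / 2 / K)); split.
  - by rewrite lt_min invr_gt0 !divr_gt0 ?mulr_gt0.
  - by rewrite mulrA mulrC -ler_pdivlMr ?mulr_gt0// div1r ge_min lexx.
  - by rewrite -ler_pdivlMr// ge_min lexx orbT.
have [I [T [rep [mT repU repT]]]] := discretize fB t0.
have [rho rhoP] := combined.
have [m0 Hm0] := finite_grid_approx rho d2 mT t0.
pose m := (m0 + (Num.truncn (4 * J ^+ 2 / eps)).+1)%N.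
have me : J ^+ 2 * (2 * m.+1%:R^-1) <= eps / 2.
  have : (m.+1%:R)^-1 <= eps / (4 * J ^+ 2).
    rewrite -[leRHS]invrK lef_pV2 ?posrE ?invr_gt0 ?divr_gt0 ?mulr_gt0 ?exprn_gt0// invf_div.
    apply: le_trans (ltW (truncnS_gt _)) _; rewrite ler_nat.
    by apply: leqW; rewrite leq_addl.
  rewrite ler_pdivlMr ?mulr_gt0 ?exprn_gt0//.
  by move: (_^-1) => v; lra.
have [T' [mW0 W0]] := Hm0 m (leq_addr _ _).
pose W : set (measurableTypeR R) := unit_itv R `&` [set z | T z <> T' (cell d m z)].
have mW : measurable W by exact: measurableI.
have [Wleb Wx Wy] := rhoP W mW.
pose Q i s := f i (rep (T' s)).
have Q01 i s : 0 <= Q i s <= 1 by exact: f01.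
have fQ i z : unit_itv R z -> ~ W z -> `|f i z - Q i (cell d m z)| <= tau.
  move=> Uz nW; have [TE|nT] := pselect (T z = T' (cell d m z)).
    by rewrite /Q -TE; exact: repT.
  by case: nW.
pose E := last_children d a b m `|` (x @^-1` W `|` y @^-1` W).
have mlast := measurable_last_children model m.
have mxW : measurable (x @^-1` W) by rewrite -[X in measurable X]setTI; exact: mx.
have myW : measurable (y @^-1` W) by rewrite -[X in measurable X]setTI; exact: my.
have mE : measurable E by do 2 apply: measurableU => //.
have nuE : fine (nu E) <= m.+1%:R^-1 + 2 * tau.
  rewrite -lee_fin fineK ?fin_num_measure//.
  apply: le_trans (measureU2 _ mlast (measurableU _ _ mxW myW)) _.
  rewrite EFinD; apply: leeD; first exact: (last_children_mass d2 Acoh model m).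
  apply: le_trans (measureU2 _ mxW myW) _.
  by rewrite mulr_natl mulr2n EFinD; apply: leeD; [exact: le_trans Wx W0 | exact: le_trans Wy W0].
have close i t : ~ E t -> `|f i (x t) - Q i (a m t)| <= tau /\
                          `|f i (y t) - Q i (b m t)| <= tau.
  move=> /not_orP[nl /not_orP[nx ny]]; have [<- <-] := cell_of_address d2 model nl.
  by split; apply: fQ.
pose Qm : 'M[R]_(j, grid d m) := \matrix_(i, s) Q i s.
have Qm0 : nonneg_mx Qm by move=> i s; rewrite mxE; case/andP: (Q01 i s).
have Qm1 s : \sum_i Qm i s = 1 by under eq_bigr do rewrite mxE; exact: f1.
have qQ : l1_dist (model_quotient d nu a b f) (Qm *m array_mx d A m *m Qm^T) <=
    J ^+ 2 * (2 * (2 * tau * N + (m.+1%:R^-1 + 2 * tau))).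
  apply: l1_dist_le => i i'; rewrite quotient_entry.
  have -> : \sum_(v < grid d m) \sum_(w < grid d m) Qm i v * array_mx d A m v w * Qm i' w =
      \sum_(p < grid d m) \sum_(q < grid d m) Q i p * A m p q * Q i' q.
    by apply: eq_bigr => p _; apply: eq_bigr => q _; rewrite !mxE.
  apply: le_trans (model_quotient_dist d2 Acoh model mf f01 Q01 mE (ltW t0) close i i') _.
  by rewrite ler_wpM2l// lerD2l.
have Qr i : `|(\sum_s Qm i s) / (grid d m)%:R - j%:R^-1| <= 2 * tau.
  have Qint : (\sum_s Qm i s) / (grid d m)%:R = \int[leb]_(z in unit_itv R) Q i (cell d m z).
    rewrite /Rintegral (integral_cell m d2 (h := Q i)) /=; last first.
      by move=> s; case/andP: (Q01 i s).
    by under eq_bigr do rewrite mxE.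
  have fi : j%:R^-1 = \int[leb]_(z in unit_itv R) f i z by rewrite /Rintegral fint.
  rewrite Qint fi distrC.
  have mQ : measurable_fun (unit_itv R) (fun z => Q i (cell d m z)).
    exact: (@measurable_nat_comp _ _ _ (measurableTypeR R) (cell d m) (Q i) _
      (fun s => @measurable_cell R d m s d2)).
  have Uoo : (leb (unit_itv R) < +oo)%E by rewrite lebU ltry.
  apply: (@le_trans _ _ (tau * fine (leb (unit_itv R)) + fine (leb (unit_itv R `&` W)))).
    apply: Rintegral_dist_le mU mW Uoo (mf i) mQ (f01 i) _ (ltW t0) _.
    - by move=> z _; exact: Q01.
    - by move=> z; exact: fQ.
  rewrite lebU /= mulr1 mulr_natl mulr2n lerD2l -lee_fin fineK; last first.
    rewrite ge0_fin_numE//; apply: le_lt_trans Uoo; apply: le_measure; rewrite ?inE//.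
    exact: measurableI.
  by rewrite setIC; apply: le_trans Wleb W0.
have [P PK PQ] := balance_rows j0 (grid_gt0 d2 m) Qm0 Qm1 (mulr_ge0 (ler0n R 2) (ltW t0)) tJ Qr.
exists m, P => //.
have [P0 _ P1] := PK.
have A0 : nonneg_mx (array_mx d A m) by move=> p q; rewrite mxE; case: Acoh.
have QP := quotient_dist_le A0 Qm0 P0 Qm1 P1 (eta := 2 * (J * (2 * tau))).
apply: le_trans (l1_dist_triangle (Qm *m array_mx d A m *m Qm^T) _ _) _.
apply: le_trans (lerD qQ (QP _)) _.
  by move=> s; under eq_bigr do rewrite distrC; exact: PQ.
rewrite (total_mass model) -/N.
have -> : J ^+ 2 * (2 * (2 * tau * N + (m.+1%:R^-1 + 2 * tau))) +
    2 * (2 * (J * (2 * tau))) * (2 * N) = tau * K + J ^+ 2 * (2 * m.+1%:R^-1).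
  by rewrite /K; ring.
by rewrite [leRHS]splitr lerD.
Qed.

Lemma model_measure_integral (j : nat) (f : 'I_j -> measurableTypeR R -> R)
    (mu : {finite_measure set (measurableTypeR R * measurableTypeR R)%type -> \bar R}) :
  (forall g : measurableTypeR R * measurableTypeR R -> R,
     measurable_fun (unit_square R) g -> (forall z, unit_square R z -> 0 <= g z) ->
     (\int[mu]_(z in unit_square R) (g z)%:E =
      \int[nu]_t (g (x t, y t))%:E + \int[nu]_t (g (y t, x t))%:E)%E) ->
  balanced_partition_of_unity f -> forall i i',
  (\int[mu]_(z in unit_square R) (f i z.1 * f i' z.2)%:E =
   (model_quotient d nu a b f i i')%:E)%E.
Proof.
move=> muP fB i i'; have [mf f0 f1 fint] := fB; have f01 := balanced_le1 fB.
rewrite (muP (fun z => f i z.1 * f i' z.2)); last 2 first.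
- apply: measurable_funM.
    apply: (measurable_comp (F := unit_itv R)) => //; last exact: measurable_funTS.
    by move=> _ [z [] ? ? <-].
  apply: (measurable_comp (F := unit_itv R)) => //; last exact: measurable_funTS.
  by move=> _ [z [] ? ? <-].
- by move=> z [] ? ?; rewrite mulr_ge0// f0.
have intE (u v : measurableTypeR R -> measurableTypeR R) (l l' : 'I_j) :
    measurable_fun setT u -> measurable_fun setT v ->
    (forall t, unit_itv R (u t)) -> (forall t, unit_itv R (v t)) ->
    (\int[nu]_t (f l (u t) * f l' (v t))%:E = (\int[nu]_t (f l (u t) * f l' (v t)))%:E)%E.
  move=> mu' mv uU vU; rewrite /Rintegral fineK//.
  apply: integrable_fin_num => //; apply: measurable_bounded_integrable => //.
  - by rewrite ltey_eq fin_num_measure.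
  - by apply: measurable_funM;
      apply: (measurable_comp (F := unit_itv R)) => //; move=> _ [t _ <-].
  - exists 1; split; first exact: num_real.
    move=> e e1 t _; rewrite /= normrM; apply: le_trans (ltW e1).
    have /andP[? ?] := f01 l _ (uU t); have /andP[? ?] := f01 l' _ (vU t).
    by rewrite !ger0_norm// -[leRHS]mulr1 ler_pM.
by rewrite mxE EFinD !intE.
Qed.

End Directions.

Unset Implicit Arguments.

Theorem corollary4p3 (R : realType) (n : nat -> nat)
    (n_gt0 : forall i : nat, (0 < n i)%N)
    (S : forall i : nat, 'M[R]_(n i))
    (S_nonneg : forall i : nat, nonneg_mx (S i))
    (S_sym : forall i : nat, (S i)^T = S i)
    (S_cvg : convergent_mx_seq S) :
  exists mu : {finite_measure set (measurableTypeR R * measurableTypeR R)%type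
                 -> \bar R},
    [/\ supported_on_square mu,
        symmetric_measure mu
      & forall k : nat, (0 < k)%N ->
          hausdorff_cvg (fun i => mx_quotients (S i) k)
                        (measure_quotients mu k)].
Proof.
have [c [c0 Sc Scvg]] := S_cvg.
have [d [A [d2 Acoh limA]]] := limit_array n_gt0 S_nonneg S_sym c0 (fun i => ltW (Sc i)).
have [nu [a [b model]]] := random_addresses d2 Acoh.
have [mu [mu_supp mu_sym mu_int]] := address_measure d2 model.
exists mu; split => // k k0.
have [L [Lbox Lcvg]] := Scvg k k0.
have Lnn : L `<=` [set B | nonneg_mx B].
  by move=> B /Lbox /= h i j; case/andP: (h i j).
have [quotL denseL] := limA k L k0 Lnn Lcvg.
(* L is the limit already, so only the two sets have to be compared *)
suff -> : measure_quotients mu k = L by [].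
have [Lclosed _] := Lcvg.
have integralE f : balanced_partition_of_unity f -> forall i i' : 'I_k,
    (\int[mu]_(z in unit_square R) (f i z.1 * f i' z.2)%:E =
     (model_quotient d nu a b f i i')%:E)%E.
  by move=> fB i i'; exact: (model_measure_integral d2 model mu_int fB i i').
apply/seteqP; split.
  rewrite [X in _ `<=` X]((closure_id L).1 Lclosed); apply: closureS.
  move=> M [f fB Mf].
  have -> : M = model_quotient d nu a b f.
    apply/matrixP => i i'; apply: EFin_inj.
    by rewrite (Mf i i') (integralE f fB i i').
  rewrite [X in X _]((closure_id L).1 Lclosed); apply: closure_l1 => eps e0.
  have e2 : 0 < eps / 2 by rewrite divr_gt0.
  have [m [P PK fP]] := partition_grid_quotient d2 Acoh model k0 fB e2.
  exists (P *m array_mx d A m *m P^T); first exact: quotL.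
  by apply: le_lt_trans fP _; rewrite ltr_pdivrMr// ltr_pMr// ltr1n.
move=> B LB; apply: closure_l1 => eps e0.
have kp : 0 < k%:R ^+ 2 :> R by rewrite exprn_gt0// ltr0n.
have e4 : 0 < eps / 4 by rewrite divr_gt0.
have [m mm [P PK PB]] := denseL B (eps / 4) (Num.truncn (8 * k%:R ^+ 2 / eps)) LB e4.
have [f fB fP] := grid_partition_quotient d2 Acoh model k0 PK.
have me : k%:R ^+ 2 * (2 * m.+1%:R^-1) <= eps / 4.
  have k8 : 0 < 8 * k%:R ^+ 2 :> R by rewrite pmulr_rgt0.
  have : (m.+1%:R)^-1 <= eps / (8 * k%:R ^+ 2).
    have q0 : 0 < eps / (8 * k%:R ^+ 2) by rewrite divr_gt0.
    rewrite -[leRHS]invrK lef_pV2 ?posrE ?invr_gt0// invf_div.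
    by apply: le_trans (ltW (truncnS_gt _)) _; rewrite ler_nat ltnS.
  rewrite ler_pdivlMr//.
  by move: (_^-1) (_ ^+ 2) => v w; lra.
exists (model_quotient d nu a b f); first by exists f => // i i'; rewrite (integralE f fB i i').
apply: (le_lt_trans (l1_dist_triangle (P *m array_mx d A m *m P^T) _ _)).
rewrite l1_dist_sym [X in _ + X]l1_dist_sym.
apply: (le_lt_trans (lerD PB (le_trans fP me))).
by lra.
Qed.
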